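(* The first Grigorchuk group does not have Property PW.
   Context: The first Grigorchuk group is the group of automorphisms of the rooted binary tree $\{0,1\}^*$ generated by $a,b,c,d$, where $a(0w)=1w$, $a(1w)=0w$; $b(0w)=0a(w)$, $b(1w)=1c(w)$; $c(0w)=0a(w)$, $c(1w)=1d(w)$; $d(0w)=0w$, $d(1w)=1b(w)$. A group $G$ has Property PW if there exist a $G$-set $Y$ and a subset $A\subset Y$ with $gA\triangle A$ finite for all $g\in G$, such that the function $\nu_A(g)=|gA\triangle A|$ is proper, i.e. $\{g\in G:\nu_A(g)\le n\}$ is finite for every $n$. *)

(* Defs.v *)
From HB Require Import structures.
From mathcomp Require Import all_boot finmap.
From mathcomp Require Import boolp classical_sets functions cardinality.

Set Implicit Arguments.
Unset Strict Implicit.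
Unset Printing Implicit Defensive.

Local Open Scope group_scope.
Local Open Scope classical_set_scope.

(* The letter 0 is [false] and the letter 1 is [true]; the first letter of a
   word is the head of the sequence, so the children of v are the [rcons v x]. *)
Definition word := seq bool.

Definition child (v w : word) : Prop := exists x, w = rcons v x.

(* The inverse is carried along, so that bijectivity is stated by the two
   cancellation fields; it is determined by the underlying map. *)
Record tree_aut := TreeAut {
  aut_fun :> word -> word;
  aut_inv : word -> word;
  aut_funK : cancel aut_fun aut_inv;
  aut_invK : cancel aut_inv aut_fun;
  aut_root : aut_fun [::] = [::];
  aut_child : forall v w, child (aut_fun v) (aut_fun w) <-> child v w
}.

Lemma tree_aut_ext (f g : tree_aut) : aut_fun f =1 aut_fun g -> f = g.
Proof.
case: f g => [f f' fK f'K fr fc] [g g' gK g'K gr gc] /= /funext fg.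
subst g; have f'g' : f' = g'.
  by apply: funext => w; rewrite -[in LHS](g'K w) fK.
by subst g'; congr TreeAut; exact: Prop_irrelevance.
Qed.

HB.instance Definition _ := gen_eqMixin tree_aut.
HB.instance Definition _ := gen_choiceMixin tree_aut.

Section TreeAutGroup.
Implicit Types f g : tree_aut.

Definition tree_aut_one : tree_aut :=
  @TreeAut id id (fun=> erefl) (fun=> erefl) erefl (fun _ _ => iff_refl _).

Lemma tree_aut_mul_root f g : (f \o g) [::] = [::].
Proof. by rewrite /= !aut_root. Qed.

Lemma tree_aut_mul_child f g v w :
  child ((f \o g) v) ((f \o g) w) <-> child v w.
Proof. by rewrite /= aut_child aut_child. Qed.

Definition tree_aut_mul f g : tree_aut :=
  TreeAut (can_comp (@aut_funK f) (@aut_funK g))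
          (can_comp (@aut_invK g) (@aut_invK f))
          (tree_aut_mul_root f g) (tree_aut_mul_child f g).

Lemma tree_aut_inv_root f : aut_inv f [::] = [::].
Proof. by rewrite -[in LHS](aut_root f) aut_funK. Qed.

Lemma tree_aut_inv_child f v w :
  child (aut_inv f v) (aut_inv f w) <-> child v w.
Proof. by rewrite -(aut_child f) !aut_invK. Qed.

Definition tree_aut_inv f : tree_aut :=
  TreeAut (@aut_invK f) (@aut_funK f)
          (tree_aut_inv_root f) (@tree_aut_inv_child f).

Lemma tree_aut_mulA : associative tree_aut_mul.
Proof. by move=> f g h; exact: tree_aut_ext. Qed.

Lemma tree_aut_mul1 : left_id tree_aut_one tree_aut_mul.
Proof. by move=> f; exact: tree_aut_ext. Qed.

Lemma tree_aut_1mul : right_id tree_aut_one tree_aut_mul.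
Proof. by move=> f; exact: tree_aut_ext. Qed.

Lemma tree_aut_mulV : left_inverse tree_aut_one tree_aut_inv tree_aut_mul.
Proof. by move=> f; apply: tree_aut_ext => w /=; rewrite aut_funK. Qed.

Lemma tree_aut_Vmul : right_inverse tree_aut_one tree_aut_inv tree_aut_mul.
Proof. by move=> f; apply: tree_aut_ext => w /=; rewrite aut_invK. Qed.

End TreeAutGroup.

HB.instance Definition _ := isGroup.Build tree_aut
  tree_aut_mulA tree_aut_mul1 tree_aut_1mul tree_aut_mulV tree_aut_Vmul.

Definition grig_a_fun (w : word) : word :=
  if w is x :: w' then ~~ x :: w' else [::].

Fixpoint grig_b_fun (w : word) : word :=
  match w with
  | [::] => [::]
  | false :: w' => false :: grig_a_fun w'
  | true :: w' => true :: grig_c_fun w'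
  end
with grig_c_fun (w : word) : word :=
  match w with
  | [::] => [::]
  | false :: w' => false :: grig_a_fun w'
  | true :: w' => true :: grig_d_fun w'
  end
with grig_d_fun (w : word) : word :=
  match w with
  | [::] => [::]
  | false :: w' => false :: w'
  | true :: w' => true :: grig_b_fun w'
  end.

Lemma grig_a_funK : involutive grig_a_fun.
Proof. by case=> [|x w] //=; rewrite negbK. Qed.

Lemma grig_bcd_funK w :
  [/\ grig_b_fun (grig_b_fun w) = w, grig_c_fun (grig_c_fun w) = w
    & grig_d_fun (grig_d_fun w) = w].
Proof.
elim: w => [//|[] w [bK cK dK]] /=; first by rewrite bK cK dK.
by rewrite grig_a_funK.
Qed.

Lemma grig_b_funK : involutive grig_b_fun.
Proof. by move=> w; case: (grig_bcd_funK w). Qed.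

Lemma grig_c_funK : involutive grig_c_fun.
Proof. by move=> w; case: (grig_bcd_funK w). Qed.

Lemma grig_d_funK : involutive grig_d_fun.
Proof. by move=> w; case: (grig_bcd_funK w). Qed.

Lemma child_cons x v w : child v w -> child (x :: v) (x :: w).
Proof. by case=> y ->; exists y. Qed.

Lemma grig_a_child v x : child (grig_a_fun v) (grig_a_fun (rcons v x)).
Proof. by case: v => [|y v] /=; [exists (~~ x) | exists x]. Qed.

Lemma grig_bcd_child v x :
  [/\ child (grig_b_fun v) (grig_b_fun (rcons v x)),
      child (grig_c_fun v) (grig_c_fun (rcons v x))
    & child (grig_d_fun v) (grig_d_fun (rcons v x))].
Proof.
elim: v => [|[] v [bv cv dv]] /=; first by case: x; split; eexists.
- by split; exact: child_cons.
- split; apply: child_cons; [exact: grig_a_child | exact: grig_a_child |].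
  by exists x.
Qed.

Lemma grig_b_child v x : child (grig_b_fun v) (grig_b_fun (rcons v x)).
Proof. by case: (grig_bcd_child v x). Qed.

Lemma grig_c_child v x : child (grig_c_fun v) (grig_c_fun (rcons v x)).
Proof. by case: (grig_bcd_child v x). Qed.

Lemma grig_d_child v x : child (grig_d_fun v) (grig_d_fun (rcons v x)).
Proof. by case: (grig_bcd_child v x). Qed.

Lemma involutive_child (f : word -> word) : involutive f ->
  (forall v x, child (f v) (f (rcons v x))) ->
  forall v w, child (f v) (f w) <-> child v w.
Proof.
move=> fK fc v w; split=> [[x fw]|[x ->]]; last exact: fc.
by rewrite -(fK v) -(fK w) fw; exact: fc.
Qed.

Definition grig_a : tree_aut := TreeAut grig_a_funK grig_a_funK
  erefl (involutive_child grig_a_funK grig_a_child).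
Definition grig_b : tree_aut := TreeAut grig_b_funK grig_b_funK
  erefl (involutive_child grig_b_funK grig_b_child).
Definition grig_c : tree_aut := TreeAut grig_c_funK grig_c_funK
  erefl (involutive_child grig_c_funK grig_c_child).
Definition grig_d : tree_aut := TreeAut grig_d_funK grig_d_funK
  erefl (involutive_child grig_d_funK grig_d_child).

Definition generated (G : groupType) (S : set G) : pred G := fun g =>
  `[< forall H : {pred G},
        group_closed H -> (forall s, S s -> s \in H) -> g \in H >].

Lemma generated_group_closed (G : groupType) (S : set G) :
  group_closed (generated S).
Proof.
split; first by apply/asboolP => H [H1 _] _.
move=> g h /asboolP gS /asboolP hS; apply/asboolP => H Hgrp SH.
by apply: Hgrp.2; [exact: gS | exact: hS].
Qed.

Definition in_grigorchuk : pred tree_aut :=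
  generated [set g | [\/ g = grig_a, g = grig_b, g = grig_c | g = grig_d]].

Record grigorchuk := Grigorchuk {
  grig_val :> tree_aut;
  _ : in_grigorchuk grig_val
}.

HB.instance Definition _ := [isSub for grig_val].
HB.instance Definition _ := [Choice of grigorchuk by <:].
HB.instance Definition _ := SubChoice_isSubGroup.Build tree_aut in_grigorchuk
  grigorchuk (generated_group_closed _).

Record left_action (G : groupType) (Y : Type) := LeftAction {
  act :> G -> Y -> Y;
  act1 : forall y, act 1 y = y;
  actM : forall g h y, act (g * h) y = act g (act h y)
}.

Definition act_symdiff (G : groupType) (Y : Type) (to : left_action G Y)
  (A : set Y) (g : G) : set Y := (to g @` A) `+` A.

(* Only meaningful when [act_symdiff to A g] is finite: [fset_set] sends
   infinite sets to the empty set.  [{classic Y}] is Y with the choice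
   structure that [fset_set] asks for. *)
Definition nu (G : groupType) (Y : Type) (to : left_action G Y)
  (A : set Y) (g : G) : nat :=
  #|` fset_set (act_symdiff to A g : set {classic Y}) |.

Definition property_PW (G : groupType) : Prop :=
  exists (Y : Type) (to : left_action G Y) (A : set Y),
    (forall g : G, finite_set (act_symdiff to A g)) /\
    (forall n : nat, finite_set [set g : G | (nu to A g <= n)%N]).

(* Main.v *)
(* Let [A] be commensurated by an action of [G], and let [sigma] be the
   endomorphism a -> aca, b -> d, c -> b, d -> c of [G].  On the subgroup [K]
   generated by the conjugates of [(ab)^2] it is k |-> (1, k), so that
   [L1 = sigma K] and [L0 = a L1 a] commute and generate a subgroup of finite
   index.  After removing from [A] its tame part, every point of [A] lies in an
   orbit of exactly one of [L0], [L1] that [A] cuts into two infinite pieces: in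
   at least one because of the finite index, and in at most one because [L1] is
   a torsion group commuting with [L0] (an element of [L1] moving the cut of an
   [L0]-orbit far away would have infinite order).

   The part [A1] of [A] cut by [L1] is commensurated by the action of [G] through
   [sigma], and the total number of edges of the generators a, b, c, d crossing
   the cut does not increase from [A] to [A1].  On the other part, [L1] acts with
   an exponent [e] bounded in terms of this number: if [m] in [L1] has [R]
   distinct iterates at a point, then the [R] translates of a shortest path
   joining the two sides cross the cut in distinct edges.  Iterating, the
   elements [sigma^i (k^e)] move boundedly many points across the cut, uniformly
   in [i].  They are pairwise distinct as soon as [k^e <> 1], and such a [k]
   exists since [K] has unbounded exponent; so the wall function is not proper. *)
Require Import Defs.
From mathcomp Require Import all_boot finmap zify.
From mathcomp Require Import boolp classical_sets functions cardinality.

Set Implicit Arguments.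
Unset Strict Implicit.
Unset Printing Implicit Defensive.

Local Open Scope group_scope.
Local Open Scope classical_set_scope.

(** * Commensurated sets and orbits *)

(** Products of members of [S] without inverses: a submonoid in general, and a subgroup once
    [closed_inv S] holds. *)
Definition span (G : groupType) (S : seq G) : set G :=
  [set g | exists2 s, {subset s <= S} & g = foldr *%g 1 s].

Definition closed_inv (G : groupType) (S : seq G) : Prop :=
  forall s, s \in S -> s^-1 \in S.

Section Span.
Variables (G : groupType) (S : seq G).

Lemma span1 : span S 1.
Proof. by exists [::]. Qed.

Lemma span_consM s g : s \in S -> span S g -> span S (s * g).
Proof.
move=> sS [t tS ->]; exists (s :: t) => // x; rewrite inE.
by case/predU1P => [->//|/tS].
Qed.

Lemma span_gen s : s \in S -> span S s.
Proof. by move=> sS; rewrite -[s]mulg1; apply: span_consM => //; exact: span1. Qed.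

Lemma span_ind (P : G -> Prop) : P 1 ->
  (forall s g, s \in S -> span S g -> P g -> P (s * g)) ->
  forall g, span S g -> P g.
Proof.
move=> P1 Ps _ [s sS ->]; elim: s sS => [//|x s IH] sS /=.
have sS' : {subset s <= S} by move=> y ys; apply: sS; rewrite inE ys orbT.
by apply: Ps; [apply: sS; rewrite inE eqxx| exists s | exact: IH].
Qed.

Lemma spanM g h : span S g -> span S h -> span S (g * h).
Proof.
move=> gS hS; elim/span_ind: g / gS => [|s g sS _ IH]; first by rewrite mul1g.
by rewrite -mulgA; exact: span_consM.
Qed.

Lemma spanX g n : span S g -> span S (g ^+ n).
Proof.
by move=> gS; elim: n => [|n IH]; [exact: span1|rewrite expgS; exact: spanM].
Qed.

Lemma spanV g : closed_inv S -> span S g -> span S g^-1.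
Proof.
move=> SV; elim/span_ind => [|s h sS _ IH]; first by rewrite invg1; exact: span1.
by rewrite invgM; apply: spanM => //; apply/span_gen/SV.
Qed.

End Span.

Lemma sub_span (G : groupType) (S S' : seq G) :
  (forall s, s \in S -> span S' s) -> span S `<=` span S'.
Proof.
move=> SS' g; elim/span_ind => [|s h /SS' sS _ IH]; first exact: span1.
exact: spanM.
Qed.

Section Action.
Variables (G : groupType) (Y : eqType) (to : left_action G Y).
Implicit Types (A Z : set Y) (S : seq G) (g h : G) (y z : Y).

Definition orb S y : set Y := [set z | exists2 g, span S g & z = to g y].

(** This is the symmetric difference of [A] and [g^-1 A]: the tails of the [g]-edges with exactly
    one end in [A]. *)
Definition cross A g : set Y := [set y | ~ (A y <-> A (to g y))].

Definition commensurated A : Prop := forall g, finite_set (cross A g).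

Definition tame S A y : Prop :=
  finite_set (orb S y `&` A) \/ finite_set (orb S y `\` A).

Definition crossing S A : set Y := [set z | exists2 s, s \in S & cross A s z].

Lemma actK g : cancel (to g) (to g^-1).
Proof. by move=> y; rewrite -actM mulVg act1. Qed.

Lemma actVK g : cancel (to g^-1) (to g).
Proof. by move=> y; rewrite -actM mulgV act1. Qed.

Lemma act_inj g : injective (to g).
Proof. exact: can_inj (actK g). Qed.

Lemma orb_refl S y : orb S y y.
Proof. by exists 1; [exact: span1|rewrite act1]. Qed.

Lemma orb_act S g y z : span S g -> orb S y z -> orb S y (to g z).
Proof.
move=> gS [h hS ->]; exists (g * h); first exact: spanM.
by rewrite actM.
Qed.

Lemma orb_sym S y z : closed_inv S -> orb S y z -> orb S z y.
Proof. by move=> SV [g gS ->]; exists g^-1; rewrite ?actK//; exact: spanV. Qed.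

Lemma orb_trans S x y z : orb S x y -> orb S y z -> orb S x z.
Proof. by move=> xy [g gS ->]; exact: orb_act. Qed.

Lemma orb_eq S y z : closed_inv S -> orb S y z -> orb S y = orb S z.
Proof.
move=> SV yz; apply/seteqP; split=> x; last exact: orb_trans.
by apply: orb_trans; exact: orb_sym.
Qed.

Lemma tame_orb S A y z : closed_inv S -> orb S y z -> tame S A y -> tame S A z.
Proof. by move=> SV yz; rewrite /tame (orb_eq SV yz). Qed.

Lemma sub_orb S S' y : span S `<=` span S' -> orb S y `<=` orb S' y.
Proof. by move=> SS' _ [g gS ->]; exists g => //; exact: SS'. Qed.

Lemma crossC A g : cross (~` A) g = cross A g.
Proof.
apply/funext => y; apply/propext; rewrite /cross /setC /mkset.
have [Ay|Ay] := EM (A y); have [Agy|Agy] := EM (A (to g y)); tauto.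
Qed.

Lemma crossingC S A : crossing S (~` A) = crossing S A.
Proof. by apply/seteqP; split => z [s sS zs]; exists s; move: zs; rewrite ?crossC. Qed.

Lemma commensuratedC A : commensurated A -> commensurated (~` A).
Proof. by move=> Ac g; rewrite crossC. Qed.

Lemma crossing_finite S A : commensurated A -> finite_set (crossing S A).
Proof.
move=> Ac; have -> : crossing S A = \bigcup_(s in [set` S]) cross A s.
  by apply/seteqP; split=> z [s sS zs]; exists s.
by apply: bigcup_finite => [|s _]; [exact: finite_seq|exact: Ac].
Qed.

Lemma orb_const S Z y :
  (forall z s, orb S y z -> s \in S -> (Z z <-> Z (to s z))) ->
  forall z, orb S y z -> (Z z <-> Z y).
Proof.
move=> Zs _ [g gS ->]; elim/span_ind: g / gS => [|s g sS gS IH].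
  by rewrite act1.
by rewrite actM -Zs // ; exists g.
Qed.

Lemma orb_crossing S A y z z' : orb S y z -> orb S y z' -> A z -> ~ A z' ->
  exists2 v, crossing S A v & orb S y v.
Proof.
move=> yz yz' Az Az'; apply: contrapT => nv.
have cst v s : orb S y v -> s \in S -> (A v <-> A (to s v)).
  move=> yv sS; apply: contrapT => vs; apply: nv.
  by exists v => //; exists s.
by apply: Az'; apply/(orb_const cst yz')/(orb_const cst yz).
Qed.

Lemma finite_actP g Z : finite_set [set y | Z (to g y)] <-> finite_set Z.
Proof.
split=> Zf.
  apply: (sub_finite_set _ (finite_image (to g) Zf)) => y Zy.
  by exists (to g^-1 y); rewrite /= actVK.
apply: (sub_finite_set _ (finite_image (to g^-1) Zf)) => y Zy.
by exists (to g y) => //; rewrite actK.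
Qed.

(** [g] carries the [S]-orbit of [y] into the [S']-orbit of [g y], and [A] differs from [g^-1 A]
    only by the finite set [cross A g]. *)
Lemma tame_conj S S' A g y : commensurated A ->
  (forall m, span S m -> span S' (g * m * g^-1)) ->
  tame S' A (to g y) -> tame S A y.
Proof.
move=> Ac SS'.
have og z : orb S y z -> orb S' (to g y) (to g z).
  case=> m mS ->; exists (g * m * g^-1); first exact: SS'.
  by rewrite !actM actK.
case=> h; [left|right].
  have {}h : finite_set
      ([set z | (orb S' (to g y) `&` A) (to g z)] `|` cross A g).
    by rewrite finite_setU; split; [exact: (finite_actP g _).2|exact: Ac].
  apply: (sub_finite_set _ h).
  move=> z [yz Az]; have [Agz|Agz] := EM (A (to g z)).
    by left; split => //=; exact: og.
  by right => -[/(_ Az)].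
have {}h : finite_set
    ([set z | (orb S' (to g y) `\` A) (to g z)] `|` cross A g).
  by rewrite finite_setU; split; [exact: (finite_actP g _).2|exact: Ac].
apply: (sub_finite_set _ h).
move=> z [yz Az]; have [Agz|Agz] := EM (A (to g z)).
  by right => -[_ /(_ Agz)].
by left; split => //=; exact: og.
Qed.

(* On the union of the orbits that [A] meets tamely, [A] differs by finitely
   many points from a union of orbits, since only the finitely many orbits
   through crossing points are neither contained in nor disjoint from [A]. *)
Lemma tame_saturated S A : closed_inv S -> commensurated A ->
  exists2 U : set Y, (forall y z, orb S y z -> U y -> U z) &
    finite_set [set y | tame S A y /\ ~ (A y <-> U y)].
Proof.
move=> SV Ac.
(* Without the nonemptiness, finite orbits disjoint from [A], possibly infinitely many, would count
   as almost contained in [A]. *)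
pose U y := finite_set (orb S y `\` A) /\ (orb S y `&` A !=set0).
exists U => [y z yz|]; first by rewrite /U (orb_eq SV yz).
pose F v : set Y := [set z | finite_set (orb S v `&` A) /\ (orb S v `&` A) z] `|`
  [set z | finite_set (orb S v `\` A) /\ (orb S v `\` A) z].
have Ff v : finite_set (F v).
  rewrite finite_setU; split.
    have [f|f] := EM (finite_set (orb S v `&` A)).
      by apply: (sub_finite_set _ f) => z [].
    by rewrite (_ : [set _ | _] = set0)//; apply/seteqP; split => z // -[].
  have [f|f] := EM (finite_set (orb S v `\` A)).
    by apply: (sub_finite_set _ f) => z [].
  by rewrite (_ : [set _ | _] = set0)//; apply/seteqP; split => z // -[].
apply: (sub_finite_set _ (bigcup_finite (crossing_finite S Ac) (fun v _ => Ff v))).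
move=> y [ty AU].
have [Ay|Ay] := EM (A y).
  have nU : ~ finite_set (orb S y `\` A).
    move=> f; apply: AU; split => // _; split => //; exists y.
    by split => //; exact: orb_refl.
  have [z [yz Az]] : orb S y `\` A !=set0.
    apply: contrapT => /set0P/negP/negPn/eqP h; apply: nU.
    by rewrite h; exact: finite_set0.
  have [v vc yv] := orb_crossing (orb_refl S y) yz Ay Az.
  exists v => //; left; rewrite -(orb_eq SV yv); split.
    by case: ty.
  by split => //; exact: orb_refl.
have [f [z [yz Az]]] : U y by apply: contrapT => h; apply: AU.
have [v vc yv] := orb_crossing yz (orb_refl S y) Az Ay.
exists v => //; right; rewrite -(orb_eq SV yv); split => //.
by split => //; exact: orb_refl.
Qed.

(** The [S]-orbits inside the [H]-orbit of [y] are translates of one another, so all are infinite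
    and tame. The union [U] of orbits approximating [A] is invariant under [H] there: a disagreement
    between [z] and [s z] would spread along the whole infinite [S]-orbit of [z], against
    commensuration. *)
Lemma tame_normal S H A y : closed_inv S -> closed_inv H -> commensurated A ->
  (forall h m, span H h -> span S m -> span S (h * m * h^-1)) ->
  span S `<=` span H -> infinite_set (orb S y) -> tame S A y -> tame H A y.
Proof.
move=> SV HV Ac nS SH yinf ty.
have [U Usat Ufin] := tame_saturated SV Ac.
have tameH z : orb H y z -> tame S A z.
  case=> h hH ->; apply: (@tame_conj _ S _ h^-1) => //; last by rewrite actK.
  by move=> m; apply: nS; exact: spanV.
have orbinf z : orb H y z -> infinite_set (orb S z).
  case=> h hH -> f; apply: yinf.
  apply: (sub_finite_set _ ((finite_actP h _).2 f)) => _ [m mS ->] /=.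
  exists (h * m * h^-1); first exact: nS.
  by rewrite !actM actK.
have Uinv z s : orb H y z -> s \in H -> U z <-> U (to s z).
  move=> yz sH; apply: contrapT => Us.
  have yinfz := orbinf _ yz; apply: yinfz.
  have D w : orb S z w -> ~ (U w <-> U (to s w)).
    move=> zw; have wz := orb_sym SV zw.
    have sz : orb S (to s z) (to s w).
      case: zw => m mS ->; exists (s * m * s^-1).
        by apply: nS => //; exact: span_gen.
      by rewrite !actM actK.
    have sz' := orb_sym SV sz.
    apply: contra_not Us => -[h1 h2]; split.
      by move=> /(Usat _ _ zw)/h1/(Usat _ _ sz').
    by move=> /(Usat _ _ sz)/h2/(Usat _ _ wz).
  have fin : finite_set ([set y | tame S A y /\ ~ (A y <-> U y)] `|`
     ([set w | tame S A (to s w) /\ ~ (A (to s w) <-> U (to s w))] `|` cross A s)).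
    rewrite !finite_setU; split => //; split => //.
    by apply: ((finite_actP s _).2 Ufin).
  apply: (sub_finite_set _ fin) => w zw.
  have yw : orb H y w by apply: (orb_trans yz); exact: (sub_orb SH).
  have ysw : orb H y (to s w) by apply: orb_act => //; exact: span_gen.
  apply: contrapT => /not_orP[h1 /not_orP[h2 h3]]; apply: (D _ zw).
  have {}h1 : A w <-> U w.
    by apply: contrapT => h; apply: h1; split => //; exact: tameH.
  have {}h2 : A (to s w) <-> U (to s w).
    by apply: contrapT => h; apply: h2; split => //; exact: tameH.
  have {}h3 : A w <-> A (to s w) by apply: contrapT.
  by rewrite -h1 -h2.
have Ucst := orb_const Uinv.
have [Uy|Uy] := EM (U y); [right|left].
  apply: (sub_finite_set _ Ufin) => z [yz Az]; split; first exact: tameH.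
  by move=> [_ h]; apply/Az/h/Ucst.
apply: (sub_finite_set _ Ufin) => z [yz Az]; split; first exact: tameH.
by move=> [h _]; apply/Uy/(Ucst _ yz)/h.
Qed.

End Action.

(** * Commuting groups *)

Section Commuting.
Variables (G : groupType) (Y : eqType) (to : left_action G Y).
Implicit Types (A B Z : set Y) (S : seq G) (g h m : G) (y z : Y).

(** Connectedness of [B] in the Schreier graph of [S], based at [y] and expressed through the sets
    [Z] that are constant along the edges inside [B]. *)
Definition chained S B y : Prop := forall Z,
  (forall z s, B z -> s \in S -> B (to s z) -> (Z z <-> Z (to s z))) ->
  forall b, B b -> (Z b <-> Z y).

Lemma orb_chained S y v : orb to S y v ->
  exists B : set Y, [/\ finite_set B, B `<=` orb to S y, B v, B y & chained S B y].
Proof.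
case=> g gS ->; elim/span_ind: g / gS => [|s g sS gS [B [Bf By Bg yB Bc]]].
  exists [set y]; split => //; rewrite ?act1//.
  - by move=> _ ->; exact: orb_refl.
  - by move=> Z _ b ->.
exists (B `|` [set to (s * g) y]); split.
- by rewrite finite_setU; split => //; exact: finite_set1.
- move=> z [/By//|->]; exists (s * g) => //; exact: span_consM.
- by right.
- by left.
move=> Z Zs b; have ZB : forall b, B b -> (Z b <-> Z y).
  by apply: Bc => z u Bz uS Buz; apply: Zs => //; left.
case=> [/ZB//|->]; rewrite -(ZB _ Bg) actM; apply: iff_sym; apply: Zs => //.
  by left.
by right; rewrite actM.
Qed.

(** A union of finite chains from [y] to the points of [V] in its orbit, linked to one another
    through [y]. *)
Lemma finite_chained S (V : set Y) y : finite_set V ->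
  exists B : set Y, [/\ finite_set B, B `<=` orb to S y, V `&` orb to S y `<=` B,
    B y & chained S B y].
Proof.
move=> Vf.
have /choice[F FP] v : exists B : set Y, orb to S y v ->
    [/\ finite_set B, B `<=` orb to S y, B v, B y & chained S B y].
  have [/orb_chained[B BP]|nv] := EM (orb to S y v); first by exists B.
  by exists set0.
exists ([set y] `|` \bigcup_(v in V `&` orb to S y) F v); split.
- rewrite finite_setU; split; first exact: finite_set1.
  apply: bigcup_finite; first exact: finite_setIl.
  by move=> v [_ /FP[]].
- move=> z [->|[v [_ /FP[_ Fv _ _ _]] /Fv//]]; exact: orb_refl.
- by move=> v [Vv yv]; right; exists v => //; case: (FP v yv).
- by left.
move=> Z Zs b [->//|[v [Vv yv] vb]]; case: (FP v yv) => _ _ _ _; apply => //.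
by move=> z s vz sS vsz; apply: Zs => //; right; exists v.
Qed.

Lemma cross_sym A g z : cross to A g z -> cross to A g^-1 (to g z).
Proof. by rewrite /cross /= actK; tauto. Qed.

Lemma crossing_act S A s z : closed_inv S -> s \in S -> cross to A s z ->
  crossing to S A (to s z).
Proof. by move=> SV sS /cross_sym c; exists s^-1 => //; exact: SV. Qed.

Lemma orb_ind S Z y : closed_inv S ->
  (forall z s, orb to S y z -> s \in S -> Z z -> Z (to s z)) ->
  forall z, orb to S y z -> Z z -> Z y.
Proof.
move=> SV Zs z yz Zz; have [g gS ->] := orb_sym SV yz.
elim/span_ind: g / gS => [|s g sS gS IH]; first by rewrite act1.
rewrite actM; apply: Zs => //; apply: (orb_trans yz); by exists g.
Qed.

Section Far.
Variables (S : seq G) (y : Y) (B : set Y) (m : G).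
Hypotheses (SV : closed_inv S) (By : B y).
Hypothesis mS : forall g, span S g -> commute m g.
Hypothesis my : orb to S y (to m y).

Let W := orb to S y.

Lemma commuteVl g : span S g -> commute m^-1 g.
Proof.
by move=> /mS c; apply: (mulgI m); rewrite mulgA mulgV mul1g mulgA c mulgK.
Qed.

Lemma far_orb z : W z -> W (to m z).
Proof.
move=> [g gS ->]; rewrite -actM mS// actM; exact: orb_act.
Qed.

Lemma far_orbV z : W z -> W (to m^-1 z).
Proof.
move=> [g gS ->]; rewrite -actM commuteVl// actM; apply: orb_act => //.
case: my => l lS ml; exists l^-1; first exact: spanV.
by apply: (act_inj (to:=to) (g := m)); rewrite actVK -actM mS ?actM ?ml ?actK//; exact: spanV.
Qed.

(** A counterexample would put [m z] in the set [Z] of points of [m A] outside [A]. No [S]-edge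
    leaves [Z]: it would start at a crossing point of [A] or at the [m]-translate of one, and the
    hypotheses on [B] exclude both. By connectedness [y] would lie in [Z]. *)
Lemma far_nested A : crossing to S A `&` W `<=` B ->
  (forall b, B b -> A (to m b)) -> (forall b, B b -> ~ A (to m^-1 b)) ->
  forall z, W z -> A z -> A (to m z).
Proof.
move=> VB mB nB z Wz Az; apply: contrapT => Amz.
pose Z z := A (to m^-1 z) /\ ~ A z.
have /(orb_ind SV) Zy : forall z s, W z -> s \in S -> Z z -> Z (to s z).
  move=> {z Wz Az Amz} z s Wz sS [Amz Az]; split; apply: contrapT => h.
    apply: Az; rewrite -[z](actVK to m); apply: mB.
    apply: VB; split; last exact: far_orbV.
    exists s => //=; rewrite /cross /= -actM -commuteVl ?actM; last exact: span_gen.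
    by tauto.
  move/contrapT in h; apply: (nB z) => //; apply: VB; split => //.
  by exists s => //; rewrite /cross /=; tauto.
have [] := Zy (to m z); first exact: far_orb.
  by split; rewrite ?actK.
by move=> h _; exact: (nB _ By).
Qed.

(** The argument of [far_nested], with [Z] the complement of the union of [A] and [m A]. *)
Lemma far_cover A : crossing to S A `&` W `<=` B ->
  (forall b, B b -> A (to m b)) -> (forall b, B b -> A (to m^-1 b)) ->
  forall z, W z -> A z \/ A (to m^-1 z).
Proof.
move=> VB mB nB z Wz; apply: contrapT => /not_orP[Az Amz].
pose Z z := ~ A (to m^-1 z) /\ ~ A z.
have /(orb_ind SV) Zy : forall z s, W z -> s \in S -> Z z -> Z (to s z).
  move=> {z Wz Az Amz} z s Wz sS [Amz Az]; split => h.
    apply: Az; rewrite -[z](actVK to m); apply: mB.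
    apply: VB; split; last exact: far_orbV.
    exists s => //=; rewrite /cross /= -actM -commuteVl ?actM; last exact: span_gen.
    by tauto.
  apply: Amz; apply: nB => //; apply: VB; split => //.
  by exists s => //; rewrite /cross /=; tauto.
by have [] := Zy z Wz (conj Amz Az); have := nB y By.
Qed.

End Far.

Section FarAbsurd.
Variables (S : seq G) (y : Y) (B : set Y) (m : G) (r : nat).
Hypotheses (SV : closed_inv S) (By : B y) (BW : B `<=` orb to S y).
Hypothesis mS : forall g, span S g -> commute m g.
Hypothesis my : orb to S y (to m y).
Hypotheses (r0 : (0 < r)%N) (mr : m ^+ r = 1).

(** If [m^-1 B] lies in [A], then [A] and [m A] cover the orbit, so the part of the orbit outside
    [A] is finite. Otherwise [m] maps the part inside [A] into itself, hence so does [m^-1], a power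
    of [m]; but [m^-1] moves a point of [B] in [A] out of [A]. *)
Lemma far_absurd A : commensurated to A -> ~ tame to S A y ->
  crossing to S A `&` orb to S y `<=` B ->
  (forall b, B b -> A (to m b)) -> (forall b, B b -> (A (to m^-1 b) <-> A (to m^-1 y))) ->
  False.
Proof.
move=> Ac ty VB mB side; have [Amy|Amy] := EM (A (to m^-1 y)).
  have cov := far_cover SV By mS my VB mB (fun b Bb => (side b Bb).2 Amy).
  apply: ty; right; apply: (sub_finite_set _ (Ac m^-1)) => z [Wz Az].
  by rewrite /cross /=; case: (cov z Wz); tauto.
have nB b : B b -> ~ A (to m^-1 b) by move=> Bb; rewrite side.
have nest := far_nested SV By mS my VB mB nB.
have nestX i z : orb to S y z -> A z -> A (to (m ^+ i) z).
  move=> Wz Az; have : orb to S y (to (m ^+ i) z) /\ A (to (m ^+ i) z).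
    elim: i => [|i [IHW IHA]]; first by rewrite expg0 act1.
    by rewrite expgS actM; split; [exact: (far_orb mS)|exact: nest].
  by case.
have [b [Bb Ab]] : exists b, B b /\ A b.
  have [z [Wz Az]] : orb to S y `&` A !=set0.
    apply: contrapT => /set0P/negP/negPn/eqP h; apply: ty; left.
    by rewrite h; exact: finite_set0.
  have [z' [Wz' Az']] : orb to S y `\` A !=set0.
    apply: contrapT => /set0P/negP/negPn/eqP h; apply: ty; right.
    by rewrite h; exact: finite_set0.
  have [v [s sS vs] Wv] := orb_crossing Wz Wz' Az Az'.
  have [Av|Av] := EM (A v).
    by exists v; split => //; apply: VB; split => //; exists s.
  exists (to s v); split; last first.
    by apply: contrapT => Asv; apply: vs; split => [/Av|/Asv].
  apply: VB; split; first exact: crossing_act.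
  by apply: orb_act => //; exact: span_gen.
apply: (nB b Bb); have := nestX r.-1 b (BW Bb) Ab.
suff -> : m ^+ r.-1 = m^-1 by [].
by apply: (mulgI m); rewrite -expgS prednK// mr mulgV.
Qed.

End FarAbsurd.

(* An element [m] of the second group moving a connected finite set [B] off
   itself, where [B] contains all crossing points of the orbit [W], would give
   comparable sets [m A] and [A] on [W] or on the complements: strict inclusion
   contradicts torsion, the other comparisons contradict commensuration. *)
Lemma commuting_tame S S' A y : closed_inv S -> closed_inv S' ->
  (forall g m, span S g -> span S' m -> commute m g) ->
  (forall m, span S' m -> exists2 r, (0 < r)%N & m ^+ r = 1) ->
  commensurated to A -> ~ tame to S A y -> finite_set (orb to S' y).
Proof.
move=> SV SV' comm tors Ac ty; apply: contrapT => yinf.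
(* Every [S]-orbit meeting the [S']-orbit of [y] is untame, so it contains one of the finitely many
   crossing points; one such orbit contains infinitely many points of the [S']-orbit. *)
have [v [vV vinf]] : exists v, crossing to S A v /\
    ~ finite_set (orb to S' y `&` orb to S v).
  apply: contrapT => nv; apply: yinf.
  have fin v : crossing to S A v -> finite_set (orb to S' y `&` orb to S v).
    by move=> vV; apply: contrapT => h; apply: nv; exists v.
  have {}fin := bigcup_finite (crossing_finite S Ac) fin.
  apply: (sub_finite_set _ fin).
  move=> z yz; have tz : ~ tame to S A z.
    case: yz => m mS' ->; apply: contra_not ty; apply: (tame_conj Ac) => g gS.
    by rewrite (comm g m)// mulgK.
  have [u [zu Au]] : orb to S z `&` A !=set0.
    apply: contrapT => /set0P/negP/negPn/eqP h; apply: tz; left.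
    by rewrite h; exact: finite_set0.
  have [w [zw Aw]] : orb to S z `\` A !=set0.
    apply: contrapT => /set0P/negP/negPn/eqP h; apply: tz; right.
    by rewrite h; exact: finite_set0.
  have [x xV zx] := orb_crossing zu zw Au Aw.
  by exists x => //; split => //; exact: orb_sym.
have [y0 [yy0 vy0]] := infinite_setN0 vinf.
have tz : ~ tame to S A y0.
  case: yy0 => m mS' ->; apply: contra_not ty; apply: (tame_conj Ac) => g gS.
  by rewrite (comm g m)// mulgK.
rewrite (orb_eq SV' yy0) (orb_eq SV vy0) in vinf.
have [B [Bf BW VB By Bc]] := finite_chained S y0 (crossing_finite S Ac).
have /choice[l lP] b : exists l, B b -> span S l /\ b = to l y0.
  by have [/BW[l]|] := EM (B b); [exists l|exists 1].
(* Since [m b = l b (m y0)], keeping [m y0] out of this finite set ensures that [m] moves [B] off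
   itself. *)
have bad : finite_set ((fun p => to (l p.1)^-1 p.2) @` (B `*` B)).
  by apply: finite_image; exact: finite_setX.
have [z [[m mS' zE] Wz nz]] : exists z, [/\ orb to S' y0 z, orb to S y0 z &
    ~ ((fun p => to (l p.1)^-1 p.2) @` (B `*` B)) z].
  apply: contrapT => nz; apply: vinf; apply: (sub_finite_set _ bad) => z [z1 z2].
  by apply: contrapT => h; apply: nz; exists z.
subst z.
have mS g : span S g -> commute m g by move=> gS; exact: comm.
have far b : B b -> ~ B (to m b).
  move=> Bb Bmb; apply: nz; exists (b, to m b) => //=.
  have [lS bE] := lP b Bb.
  have -> : to m b = to (l b) (to m y0) by rewrite -actM -mS// actM -bE.
  by rewrite actK.
have [r r0 mr] := tors m mS'.
have side1 b : B b -> (A (to m b) <-> A (to m y0)).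
  move: b; apply: (Bc [set b | A (to m b)]) => u s Bu sS Bsu /=.
  rewrite -actM mS ?actM; last exact: span_gen.
  apply: contrapT => h; apply: (far u Bu); apply: VB; split; first by exists s.
  by apply: (far_orb mS) => //; exact: BW.
have side2 b : B b -> (A (to m^-1 b) <-> A (to m^-1 y0)).
  move: b; apply: (Bc [set b | A (to m^-1 b)]) => u s Bu sS Bsu /=.
  rewrite -actM (commuteVl mS) ?actM; last exact: span_gen.
  apply: contrapT => h; apply: (far (to m^-1 u)); last by rewrite actVK.
  apply: VB; split; first by exists s.
  by apply: (far_orbV SV mS) => //; exact: BW.
have [Amy|Amy] := EM (A (to m y0)).
  by apply: (far_absurd SV By BW mS Wz r0 mr Ac tz VB _ side2) => b /side1 ->.
apply: (far_absurd (A := ~` A) SV By BW mS Wz r0 mr).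
- exact: commensuratedC.
- by apply: contra_not tz; rewrite /tame setDE setCK -setDE or_comm.
- by rewrite crossingC.
- by move=> b /side1 h; rewrite /setC /= h.
- by move=> b /side2 h; rewrite /setC /= h.
Qed.

End Commuting.

(** * Periods bounded by the number of crossing edges *)

Section Period.
Variables (G : groupType) (Y : eqType) (to : left_action G Y).
Implicit Types (A B Z : set Y) (g h : G) (z : Y).
Variables (S : seq G) (y : Y) (m : G) (r : nat).
Hypotheses (SV : closed_inv S) (r0 : (0 < r)%N) (mr : m ^+ r = 1).
Hypothesis mS : forall g, span S g -> commute m g.

Let W := orb to S y.

Lemma commute_actX g i z : span S g ->
  to (m ^+ i) (to g z) = to g (to (m ^+ i) z).
Proof.
by move=> /mS c; rewrite -!actM; congr (to _ _); apply/esym/commuteX/esym.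
Qed.

Lemma expg_modr i : m ^+ i = m ^+ (i %% r).
Proof. by rewrite {1}(divn_eq i r) mulnC expgnDr expgnA mr expg1n mul1g. Qed.

Lemma expg_opp i : exists j, m ^+ j * m ^+ i = 1.
Proof.
exists (r * i - i)%N; rewrite -expgnDr subnK ?expgnA ?mr ?expg1n//.
by rewrite leq_pmull.
Qed.

(** Points of [A] that some power of [m] moves out of [A] lie in finitely many finite sets
    [cross to A (m ^+ i)], since exponents matter only modulo [r]. *)
Lemma deep_point A : commensurated to A -> infinite_set (W `&` A) ->
  exists2 z, W z & forall i, A (to (m ^+ i) z).
Proof.
move=> Ac Winf; apply: contrapT => nz; apply: Winf.
have fin : finite_set (\bigcup_(i in `I_r) cross to A (m ^+ i)).
  by apply: bigcup_finite => [|i _]; [exact: finite_II|exact: Ac].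
apply: (sub_finite_set _ fin) => z [Wz Az]; apply: contrapT => nc; apply: nz.
exists z => // i; apply: contrapT => Aiz; apply: nc; exists (i %% r)%N => /=.
  by rewrite ltn_mod.
by rewrite /cross /= -expg_modr; tauto.
Qed.

Lemma period_bound A (E : seq (G * Y)) : commensurated to A -> ~ tame to S A y ->
  (forall s z, s \in S -> cross to A s z -> (s, z) \in E) ->
  exists R, [/\ (0 < R)%N, (R <= size E)%N & to (m ^+ R) y = y].
Proof.
move=> Ac ty AE.
have exR : exists R, (0 < R)%N && (to (m ^+ R) y == y).
  by exists r; rewrite r0 mr act1 eqxx.
case: (ex_minnP exR) => R /andP[R0 /eqP Ry] Rmin; exists R; split => //.
have freey i j : (i <= j < R)%N -> to (m ^+ i) y = to (m ^+ j) y -> i = j.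
  case/andP; rewrite leq_eqVlt => /predU1P[//|ij] jR.
  rewrite -(subnKC (ltnW ij)) expgnDr actM => /act_inj h.
  have := Rmin (j - i)%N; rewrite subn_gt0 ij -h eqxx => /(_ isT).
  by rewrite leqNgt (leq_ltn_trans (leq_subr _ _) jR).
have free z i j : W z -> (i < R)%N -> (j < R)%N ->
    to (m ^+ i) z = to (m ^+ j) z -> i = j.
  move=> [g gS ->] iR jR; rewrite !commute_actX// => /act_inj h.
  have [ij|ji] := leqP i j; first by apply: freey; rewrite ?ij.
  by apply/esym/freey => //; rewrite ltnW.
(* The whole [m]-orbit has to lie on one side, so that every translate of a path between deep points
   of opposite sides crosses the cut. *)
pose deep A z := forall i, A (to (m ^+ i) z).
have [z0 Wz0 Az0] : exists2 z, W z & deep A z.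
  by apply: deep_point => // h; apply: ty; left.
have [z1 Wz1 Az1] : exists2 z, W z & deep (~` A) z.
  apply: deep_point; first exact: commensuratedC.
  by move=> h; apply: ty; right; rewrite setDE.
have deepX B i z : deep B z -> deep B (to (m ^+ i) z).
  by move=> Bz j; rewrite -actM -expgnDr.
have deepI B i z : deep B (to (m ^+ i) z) -> deep B z.
  have [j ji] := expg_opp i.
  by move=> /(deepX _ j); rewrite -actM ji act1.
pose path n := exists z (t : seq G), [/\ W z, deep A z, {subset t <= S},
  size t = n & deep (~` A) (to (foldr *%g 1 t) z)].
have expath : exists n, `[< path n >].
  have [g [t tS gE] zE] := orb_trans (orb_sym SV Wz0) Wz1.
  exists (size t); apply/asboolP; exists z0, t; split => //.
  by rewrite -gE -zE.
case: (ex_minnP expath) => n /asboolP[z [t [Wz Az tS tn Atz]]] nmin.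
(* Words act from the right, so the path runs through decreasing indices: [p n] is its start [z] and
   [p 0] its end. *)
pose p j := to (foldr *%g 1 (drop j t)) z.
have spanp j : span S (foldr *%g 1 (drop j t)).
  by exists (drop j t) => // x /mem_drop/tS.
have Wp j : W (p j) by apply: orb_act.
have pS j : (j < n)%N -> p j = to (nth 1 t j) (p j.+1).
  by move=> jn; rewrite /p (drop_nth 1) ?tn//= actM.
have p0 : p 0 = to (foldr *%g 1 t) z by rewrite /p drop0.
have pn : p n = z by rewrite /p drop_oversize ?tn//= act1.
(* The translate by [m ^+ i] starts in [A] and ends outside, so it has a crossing edge; [f i]
   selects one. *)
have /choice[f fP] i : exists j, (j < n)%N /\
    cross to A (nth 1 t j) (to (m ^+ i) (p j.+1)).
  apply: contrapT => nj.
  have step k : (k <= n)%N -> A (to (m ^+ i) (p (n - k))).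
    elim: k => [_|k IH kn]; first by rewrite subn0 pn.
    apply: contrapT => h; apply: nj; exists (n - k.+1)%N; split.
      by rewrite ltn_subrL (leq_ltn_trans _ kn).
    rewrite /cross /= -(@commute_actX _ i); last first.
      by apply: span_gen; apply: tS; apply: mem_nth; rewrite tn ltn_subrL (leq_ltn_trans _ kn).
    rewrite -pS; last by rewrite ltn_subrL (leq_ltn_trans _ kn).
    by rewrite subnSK//; have := IH (ltnW kn); tauto.
  by have := step n (leqnn n); rewrite subnn p0; exact: Atz.
(* Two translates of the path can only meet at corresponding vertices, since
   otherwise the translates could be spliced into a shorter path. *)
have splice i i' j j' : (j < j')%N -> (j' <= n)%N ->
    to (m ^+ i) (p j) <> to (m ^+ i') (p j').
  move=> jj' j'n pjj'.
  have [k ki] := expg_opp i.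
  have pj : p j = to (m ^+ (k + i')) (p j').
    by rewrite expgnDr actM -pjj' -actM ki act1.
  have : path (j + (n - j'))%N.
    exists (to (m ^+ (k + i')) z), (take j t ++ drop j' t); split.
    - apply: (orb_trans (Wp j)); rewrite pj /p commute_actX//.
      by apply: orb_sym => //; exists (foldr *%g 1 (drop j' t)).
    - exact: deepX.
    - by move=> x; rewrite mem_cat => /orP[/mem_take|/mem_drop] /tS.
    - by rewrite size_cat size_drop size_take tn (leq_trans jj').
    have foldrM (u v : seq G) :
        foldr *%g 1 (u ++ v) = foldr *%g 1 u * foldr *%g 1 v.
      by elim: u => [|x u IH] /=; rewrite ?mul1g// IH mulgA.
    by rewrite foldrM actM -commute_actX// -pj /p -actM -foldrM cat_take_drop.
  move=> /asboolP/nmin; apply/negP; rewrite -ltnNge -[X in (_ < X)%N](subnK j'n).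
  by rewrite addnC ltn_add2l.
have inj : {in iota 0 R &, injective (fun i => (nth 1 t (f i), to (m ^+ i) (p (f i).+1)))}.
  move=> i i'; rewrite !mem_iota !add0n /= => iR i'R [_ eqp].
  have [fn _] := fP i; have [fn' _] := fP i'.
  have [lt|lt|eqf] := ltngtP (f i) (f i').
  - by case: (splice i i' (f i).+1 (f i').+1).
  - by case: (splice i' i (f i').+1 (f i).+1).
  by rewrite eqf in eqp; exact: (free _ _ _ (Wp _) iR i'R eqp).
rewrite -[R](size_iota 0) -(size_map (fun i => (nth 1 t (f i), to (m ^+ i) (p (f i).+1)))).
apply: uniq_leq_size; first by rewrite map_inj_in_uniq ?iota_uniq.
move=> _ /mapP[i _ ->]; have [fn c] := fP i; apply: AE => //.
by apply: tS; apply: mem_nth; rewrite tn.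
Qed.

End Period.

(** * Self-similar actions *)

Lemma commute_conj (G : groupType) (g h : G) : commute g h -> g * h * g^-1 = h.
Proof. by move=> ->; rewrite mulgK. Qed.

Lemma conj_mul (G : groupType) (g h k : G) :
  g * h * k * (g * h)^-1 = g * (h * k * h^-1) * g^-1.
Proof. by rewrite invgM !mulgA. Qed.

(** On the tame part [A] agrees with an invariant set up to the finite set [D]. Hence each crossing
    edge there has an end in [D], which adds at most twice the length of [D], uniformly in [g]. *)
Lemma untame_part (G : groupType) (Y : eqType) (to : left_action G Y) (S : seq G)
    (A : set Y) : closed_inv S -> (forall g, span S g) -> commensurated to A ->
  let A' := A `&` [set y | ~ tame to S A y] in
  [/\ commensurated to A', (forall y, A' y -> ~ tame to S A' y) &
   exists D : seq Y, forall g, cross to A g `<=`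
     cross to A' g `|` [set` D ++ [seq to g^-1 y | y <- D]]].
Proof.
move=> SV Sgen Ac A'.
have ty g y : tame to S A (to g y) <-> tame to S A y.
  have yg : orb to S y (to g y) by exists g.
  by split; apply: tame_orb => //; exact: orb_sym.
split.
- move=> g; apply: (sub_finite_set _ (Ac g)) => y.
  by rewrite /cross /A' /setI /=; have := ty g y; tauto.
- move=> y [Ay nt]; apply: contra_not (nt) => t.
  have oA' z : orb to S y z -> (A' z <-> A z).
    by case=> g _ ->; move: nt; rewrite /A' /setI /=; have := ty g y; tauto.
  by case: t => f; [left|right]; apply: (sub_finite_set _ f) => z [yz Az];
    split => //; apply/oA'.
have [U Usat Ufin] := tame_saturated SV Ac.
have /finite_seqP[D DE] := Ufin; exists D => // g y yc.
have [t|t] := EM (tame to S A y); last first.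
  left; move: yc; rewrite /cross /A' /setI /=; have := ty g y; tauto.
right; rewrite /= mem_cat; apply: contrapT => /negP; rewrite negb_or => /andP[yD gyD].
have yU : A y <-> U y.
  apply: contrapT => h; have : [set` D] y by rewrite -DE.
  by rewrite /= (negbTE yD).
have gyU : A (to g y) <-> U (to g y).
  apply: contrapT => h.
  have : [set` D] (to g y) by rewrite -DE; split => //; apply/ty.
  move=> /= gD; move/negP: gyD; apply; apply/mapP; exists (to g y) => //.
  by rewrite actK.
have yg : orb to S y (to g y) by exists g.
have gy := orb_sym SV yg.
have := Usat _ _ yg; have := Usat _ _ gy; move: yc; rewrite /cross /=; tauto.
Qed.

Lemma nu_le (G : groupType) (Y : Type) (to : left_action G Y) (A : set Y) g
    (l : seq {classic Y}) : finite_set (act_symdiff to A g) ->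
  (act_symdiff to A g : set {classic Y}) `<=` [set` l] -> (nu to A g <= size l)%N.
Proof.
move=> f sub; rewrite /nu; apply: uniq_leq_size; first exact: fset_uniq.
by move=> y; rewrite in_fset_set// => /set_mem/sub.
Qed.

Lemma injective_infinite (T : eqType) (S : set T) (f : nat -> T) :
  injective f -> (forall i, S (f i)) -> infinite_set S.
Proof.
move=> finj Sf /finite_seqP[s sE].
have : (size [seq f i | i <- iota 0 (size s).+1] <= size s)%N.
  apply: uniq_leq_size; first by rewrite map_inj_uniq ?iota_uniq.
  by move=> _ /mapP[i _ ->]; have := Sf i; rewrite sE.
by rewrite size_map size_iota ltnn.
Qed.

Lemma symdiff_cross (G : groupType) (Y : eqType) (to : left_action G Y)
  (A : set Y) g : act_symdiff to A g^-1 = cross to A g.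
Proof.
apply/seteqP; split=> y; rewrite /act_symdiff /cross /setY /=.
  case=> -[].
    by case=> z Az <-; rewrite actVK; tauto.
  move=> Ay h [/(_ Ay) Agy _]; apply: h; exists (to g y) => //; exact: actK.
move=> h; have [Ay|Ay] := EM (A y).
  right; split => // -[z Az zy]; apply: h; split=> // _.
  by rewrite -zy actVK.
left; split => //; exists (to g y); last exact: actK.
by apply: contrapT => Agy; apply: h; split => [/Ay|/Agy].
Qed.

Section SelfSimilar.
Variables (G : groupType) (a b c d : G) (sigma : G -> G) (SK : seq G).

Let Gs := [:: a; b; c; d].
Let S1 := [seq sigma k | k <- SK].
Let S0 := [seq a * sigma k * a^-1 | k <- SK].

Hypothesis Ggen : forall g, span Gs g.
Hypothesis GsV : closed_inv Gs.
Hypothesis aV : a^-1 = a.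
Hypothesis b_cd : b = c * d.
Hypothesis sigmaM : {morph sigma : x y / x * y}.
Hypothesis sigma_a : sigma a = a * c * a.
Hypothesis sigma_b : sigma b = d.
Hypothesis sigma_c : sigma c = b.
Hypothesis sigma_d : sigma d = c.
Hypothesis SKV : closed_inv SK.
Hypothesis Knormal : forall g k, span SK k -> span SK (g * k * g^-1).
Hypothesis Ksigma : forall k, span SK k -> span SK (sigma k).
Hypothesis Kcomm : forall k k', span SK k -> span SK k' ->
  commute (sigma k) (a * sigma k' * a^-1).
Hypothesis Kcomm_d : forall k, span SK k -> commute (sigma k) (a * d * a).
Hypothesis Kcover : exists T : seq G, forall g, exists t n,
  [/\ t \in T, span (S0 ++ S1) n & g = t * n].
Hypothesis Ktors : forall k, span SK k -> exists2 r, (0 < r)%N & k ^+ r = 1.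

Lemma aa : a * a = 1.
Proof. by rewrite -{1}aV mulVg. Qed.

Lemma sigma1 : sigma 1 = 1.
Proof. by apply: (mulgI (sigma 1)); rewrite -sigmaM !mulg1. Qed.

Lemma sigmaV g : sigma g^-1 = (sigma g)^-1.
Proof. by apply: (mulgI (sigma g)); rewrite -sigmaM !mulgV sigma1. Qed.

Lemma sigmaX g n : sigma (g ^+ n) = sigma g ^+ n.
Proof. by elim: n => [|n IH]; rewrite ?sigma1// !expgS sigmaM IH. Qed.

Lemma iter_sigmaX i g n : iter i sigma (g ^+ n) = iter i sigma g ^+ n.
Proof. by elim: i => //= i ->; rewrite sigmaX. Qed.

Lemma span_S1 m : span S1 m <-> exists2 k, span SK k & m = sigma k.
Proof.
split=> [|[k kK ->]].
  elim/span_ind=> [|s g /mapP[k kK ->] _ [l lK ->]].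
    by exists 1; [exact: span1|rewrite sigma1].
  by exists (k * l); [exact: span_consM|rewrite sigmaM].
elim/span_ind: k / kK => [|s g sS _ IH]; first by rewrite sigma1; exact: span1.
by rewrite sigmaM; apply: span_consM => //; exact: map_f.
Qed.

Lemma span_S0 m : span S0 m <-> exists2 k, span S1 k & m = a * k * a^-1.
Proof.
split=> [|[k kK ->]].
  elim/span_ind=> [|s g /mapP[k kK ->] _ [l lK ->]].
    by exists 1; [exact: span1|rewrite mulg1 mulgV].
  exists (sigma k * l); first by apply: span_consM => //; exact: map_f.
  by rewrite !mulgA mulgVK.
elim/span_ind: k / kK => [|s g /mapP[k kK ->] _ IH].
  by rewrite mulg1 mulgV; exact: span1.
have -> : a * (sigma k * g) * a^-1 = (a * sigma k * a^-1) * (a * g * a^-1).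
  by rewrite !mulgA mulgVK.
by apply: span_consM => //; apply/mapP; exists k.
Qed.

Lemma S1V : closed_inv S1.
Proof. by move=> _ /mapP[k kK ->]; rewrite -sigmaV map_f// SKV. Qed.

Lemma S0V : closed_inv S0.
Proof.
move=> _ /mapP[k kK ->]; apply/mapP; exists k^-1; first exact: SKV.
by rewrite sigmaV !invgM invgK mulgA.
Qed.

Lemma S01V : closed_inv (S0 ++ S1).
Proof.
by move=> s; rewrite !mem_cat => /orP[/S0V ->|/S1V ->]; rewrite ?orbT.
Qed.

Lemma comm01 g m : span S0 g -> span S1 m -> commute m g.
Proof.
by move=> /span_S0[k /span_S1[l lK ->] ->] /span_S1[k' k'K ->]; exact: Kcomm.
Qed.

Lemma conj_sigma g m : span S1 m -> span S1 (sigma g * m * (sigma g)^-1).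
Proof.
move=> /span_S1[k kK ->]; apply/span_S1; exists (g * k * g^-1).
  exact: Knormal.
by rewrite !sigmaM sigmaV.
Qed.

Lemma conj_a1 m : span S1 m -> span S0 (a * m * a^-1).
Proof. by move=> mS; apply/span_S0; exists m. Qed.

Lemma conj_a0 m : span S0 m -> span S1 (a * m * a^-1).
Proof. by move=> /span_S0[k kS ->]; rewrite aV -!mulgA aa mulg1 mulgA aa mul1g. Qed.

Lemma conj_bcd1 s m : s \in [:: b; c; d] -> span S1 m -> span S1 (s * m * s^-1).
Proof.
rewrite !inE => /or3P[]/eqP-> mS; [rewrite -sigma_c|rewrite -sigma_d|rewrite -sigma_b].
all: exact: conj_sigma.
Qed.

(** [aca] is [sigma a], [ada] commutes with [sigma K], and [b = cd] makes [aba] the product of these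
    two. *)
Lemma conj_a_bcd1 s m : s \in [:: b; c; d] -> span S1 m ->
  span S1 ((a * s * a) * m * (a * s * a)^-1).
Proof.
have conj_d n : span S1 n -> (a * d * a) * n * (a * d * a)^-1 = n.
  move=> /span_S1[k kK ->]; apply: commute_conj; apply/esym; exact: Kcomm_d.
rewrite !inE => /or3P[]/eqP-> mS; last by rewrite conj_d.
  have -> : a * b * a = sigma a * (a * d * a).
    by rewrite sigma_a b_cd -[X in _ * (X * _ * _)]aV !mulgA mulgK.
  rewrite conj_mul conj_d//.
  exact: conj_sigma.
by rewrite -sigma_a; exact: conj_sigma.
Qed.

Lemma conj_bcd0 s m : s \in [:: b; c; d] -> span S0 m -> span S0 (s * m * s^-1).
Proof.
move=> sb /span_S0[k kS ->]; have := conj_a1 (conj_a_bcd1 sb kS).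
suff -> : a * (a * s * a * k * (a * s * a)^-1) * a^-1 = s * (a * k * a^-1) * s^-1.
  by [].
by rewrite -!conj_mul !mulgA aa mul1g.
Qed.

Lemma conj01 g n : span (S0 ++ S1) n -> span (S0 ++ S1) (g * n * g^-1).
Proof.
have [i0 i1] : span S0 `<=` span (S0 ++ S1) /\ span S1 `<=` span (S0 ++ S1).
  by split; apply: sub_span => s sS; apply: span_gen; rewrite mem_cat sS ?orbT.
move: n; elim/span_ind: g / (Ggen g) => [n nS|s g sG _ IH n0 /IH].
  by rewrite mul1g invg1 mulg1.
rewrite conj_mul; move: (g * n0 * g^-1) => n {IH}.
move=> nS; elim/span_ind: n / nS => [|x n xS _ IH].
  by rewrite mulg1 mulgV; exact: span1.
have -> : s * (x * n) * s^-1 = (s * x * s^-1) * (s * n * s^-1).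
  by rewrite !mulgA mulgVK.
apply: spanM => // {IH}; move: sG; rewrite inE => /predU1P[->|sG].
  move: xS; rewrite mem_cat => /orP[/span_gen/conj_a0/i1//|/span_gen/conj_a1/i0//].
move: xS; rewrite mem_cat => /orP[/span_gen/(conj_bcd0 sG)/i0//|].
by move=> /span_gen/(conj_bcd1 sG)/i1.
Qed.

Lemma span01 n : span (S0 ++ S1) n ->
  exists l m, [/\ span S0 l, span S1 m & n = m * l].
Proof.
elim/span_ind=> [|s g sS _ [l [m [lS mS ->]]]].
  by exists 1, 1; rewrite mulg1; split => //; exact: span1.
move: sS; rewrite mem_cat => /orP[] sS.
  exists (s * l), m; split => //; first exact: span_consM.
  by rewrite !mulgA (comm01 _ mS)//; exact: span_gen.
exists l, (s * m); split => //; first exact: span_consM.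
by rewrite mulgA.
Qed.

(** * Passing from an action to the action through [sigma] *)

Section Action.
Variable Y : eqType.
Implicit Types (to : left_action G Y) (A : set Y).

Definition clean to A : Prop := forall y, A y -> ~ tame to Gs A y.

(** Lists replace cardinalities, because [small_sigma] filters the edges by type and redistributes
    them among the generators. *)
Definition small to A n : Prop := exists la lb lc ld : seq Y,
  [/\ [/\ cross to A a `<=` [set` la], cross to A b `<=` [set` lb],
          cross to A c `<=` [set` lc] & cross to A d `<=` [set` ld]] &
      (size la + size lb + size lc + size ld <= n)%N].

Lemma cross_word to A n s : small to A n -> {subset s <= Gs} ->
  exists2 l : seq Y, cross to A (foldr *%g 1 s) `<=` [set` l] &
    (size l <= size s * n)%N.
Proof.
move=> [la [lb [lc [ld [[Ha Hb Hc Hd] len]]]]].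
have letter x : x \in Gs -> exists2 l : seq Y, cross to A x `<=` [set` l] &
    (size l <= n)%N.
  rewrite !inE => /or4P[]/eqP->; [exists la|exists lb|exists lc|exists ld] => //;
    by move: len; clear; lia.
elim: s => [_|x s IH sG] /=; first by exists [::] => // y; rewrite /cross /= act1; tauto.
have [l lP ls] : exists2 l : seq Y, cross to A (foldr *%g 1 s) `<=` [set` l] &
    (size l <= size s * n)%N.
  by apply: IH => z zs; apply: sG; rewrite inE zs orbT.
have [lx lxP lxs] := letter x (sG x (mem_head _ _)).
exists ([seq to (foldr *%g 1 s)^-1 y | y <- lx] ++ l); last first.
  by rewrite size_cat size_map mulSn leq_add.
move=> y; rewrite /cross /= actM mem_cat => xy.
have [h|h] := EM (cross to A (foldr *%g 1 s) y).
  by rewrite (lP _ h) orbT.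
have /lxP /= h' : cross to A x (to (foldr *%g 1 s) y).
  by rewrite /cross /=; move/contrapT : h; tauto.
by apply/orP; left; apply/mapP; exists (to (foldr *%g 1 s) y); rewrite ?actK.
Qed.

(** [k] is the total length of words for the members of [S], so it is independent of the action and
    of [A], both of which change along the iteration. *)
Lemma edges_word (S : seq G) : exists k, forall to A n, small to A n ->
  exists2 E : seq (G * Y), (size E <= k * n)%N &
    forall s z, s \in S -> cross to A s z -> (s, z) \in E.
Proof.
elim: S => [|s S [k IH]]; first by exists 0 => to A n _; exists [::].
have [t tG sE] := Ggen s; exists (size t + k)%N => to A n sm.
have [E EP Es] := IH to A n sm; have [l lP ls] := cross_word sm tG.
exists ([seq (s, z) | z <- l] ++ E).
  by rewrite size_cat size_map mulnDl leq_add.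
move=> x z; rewrite inE mem_cat => /predU1P[->|xS] xz; last first.
  by rewrite Es ?orbT.
by apply/orP; left; apply: map_f; apply: lP; rewrite -sE.
Qed.

Section Types.
Variables (to : left_action G Y) (A : set Y).
Hypothesis Ac : commensurated to A.

Let T0 y := ~ tame to S0 A y.
Let T1 y := ~ tame to S1 A y.

(** An untame [S0]-orbit forces the [S1]-orbit to be finite, by [commuting_tame], and finite orbits
    are tame. *)
Lemma T01_disjoint y : T0 y -> T1 y -> False.
Proof.
move=> t0 t1; apply: t1; left; apply: finite_setIl.
apply: (commuting_tame S0V S1V _ _ Ac t0); first exact: comm01.
move=> m /span_S1[k kK ->]; have [r r0 kr] := Ktors kK.
by exists r => //; rewrite -sigmaX kr sigma1.
Qed.

Lemma T1_sigma g y : T1 (to (sigma g) y) <-> T1 y.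
Proof.
rewrite /T1; apply: not_iff_compat; split.
  by apply: tame_conj => // m; exact: conj_sigma.
move=> t; apply: (@tame_conj _ _ to S1 S1 A (sigma g)^-1) => //; last first.
  by rewrite actK.
by move=> m; rewrite -sigmaV; exact: conj_sigma.
Qed.

Lemma T0_S1 m y : span S1 m -> T0 (to m y) <-> T0 y.
Proof.
move=> mS; rewrite /T0; apply: not_iff_compat; split.
  apply: tame_conj => // g gS; rewrite commute_conj//; exact: comm01.
move=> t; apply: (@tame_conj _ _ to S0 S0 A m^-1) => //; last by rewrite actK.
move=> g gS; rewrite commute_conj//; apply: comm01 => //; apply: spanV => //.
exact: S1V.
Qed.

Lemma T0_a y : T1 y -> T0 (to a y).
Proof.
by apply: contra_not; apply: tame_conj => // m; exact: conj_a1.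
Qed.

Lemma T0_bcd s y : s \in [:: b; c; d] -> T0 y -> T0 (to s y).
Proof.
by move=> sb; apply: contra_not; apply: tame_conj => // m; exact: conj_bcd0.
Qed.

(** Suppose both orbits are tame. If one is infinite, [tame_normal] lifts tameness to the subgroup
    generated by [S0] and [S1] and then to the whole group. If both are finite, finite index makes
    the whole orbit finite. *)
Lemma T01_typed y : ~ tame to Gs A y -> T0 y \/ T1 y.
Proof.
move=> ty; apply: contrapT => /not_orP[/contrapT t0 /contrapT t1]; apply: ty.
have [i0 i1] : span S0 `<=` span (S0 ++ S1) /\ span S1 `<=` span (S0 ++ S1).
  by split; apply: sub_span => s sS; apply: span_gen; rewrite mem_cat sS ?orbT.
have up : infinite_set (orb to (S0 ++ S1) y) -> tame to (S0 ++ S1) A y ->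
    tame to Gs A y.
  move=> yinf; apply: tame_normal S01V GsV Ac _ _ yinf => [g m _|g _].
    exact: conj01.
  exact: Ggen.
have [f0|f0] := EM (finite_set (orb to S0 y)); last first.
  apply: up.
    by apply: contra_not f0; apply: sub_finite_set; exact: sub_orb.
  apply: (tame_normal S0V S01V Ac) => // h m /span01[l [n [lS nS ->]]] mS.
  rewrite conj_mul commute_conj.
    by apply: spanM; [exact: spanM|apply: spanV => //; exact: S0V].
  apply: comm01 => //; apply: spanM; first exact: spanM.
  by apply: spanV => //; exact: S0V.
have [f1|f1] := EM (finite_set (orb to S1 y)); last first.
  apply: up.
    by apply: contra_not f1; apply: sub_finite_set; exact: sub_orb.
  apply: (tame_normal S1V S01V Ac) => // h m /span01[l [n [lS nS ->]]] mS.
  rewrite conj_mul (@commute_conj _ l m).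
    by apply: spanM; [exact: spanM|apply: spanV => //; exact: S1V].
  by apply/esym; exact: comm01.
left; apply: finite_setIl; have [T TP] := Kcover.
have fin t z : orb to S1 y z -> finite_set (to t @` orb to S0 z).
  case=> m mS ->; apply: finite_image.
  apply: (sub_finite_set _ (finite_image (to m) f0)) => _ [l lS ->].
  by exists (to l y); [exists l|rewrite -!actM (comm01 lS mS)].
have {}fin : finite_set (\bigcup_(t in [set` T]) \bigcup_(z in orb to S1 y)
    (to t @` orb to S0 z)).
  apply: bigcup_finite; first exact: finite_seq.
  by move=> t _; apply: bigcup_finite => // z; exact: fin.
apply: (sub_finite_set _ fin) => _ [g _ ->].
have [t [n [tT /span01[l [m [lS mS ->]]] ->]]] := TP g.
exists t => //; exists (to m y); first by exists m.
by exists (to l (to m y)); [exists l|rewrite -!actM (comm01 lS mS) mulgA].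
Qed.

Lemma sigma_act1 y : to (sigma 1) y = y.
Proof. by rewrite sigma1 act1. Qed.

Lemma sigma_actM g h y : to (sigma (g * h)) y = to (sigma g) (to (sigma h) y).
Proof. by rewrite sigmaM actM. Qed.

Definition sigma_action : left_action G Y :=
  @LeftAction G Y (fun g => to (sigma g)) sigma_act1 sigma_actM.

Lemma cross_sigma g y :
  cross sigma_action (A `&` T1) g y <-> T1 y /\ cross to A (sigma g) y.
Proof.
rewrite /cross /setI /=; have := T1_sigma g y; have := EM (T1 y); tauto.
Qed.

Lemma commensurated_sigma : commensurated sigma_action (A `&` T1).
Proof.
by move=> g; apply: (sub_finite_set _ (Ac (sigma g))) => y /cross_sigma[].
Qed.

(** The [S1]-orbit of [y] lies inside its orbit under [sigma_action], so tameness of the latter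
    would give tameness of the former. *)
Lemma clean_sigma : clean sigma_action (A `&` T1).
Proof.
move=> y [_ t1] ty; apply: (t1).
have sub z : orb to S1 y z -> orb sigma_action Gs y z /\ T1 z.
  case=> m /span_S1[k kK ->] ->; split; last exact/T1_sigma.
  by exists k; first exact: Ggen.
case: ty => f; [left|right]; apply: (sub_finite_set _ f) => z [yz Az].
  by have [] := sub z yz.
by have [] := sub z yz; split => // -[].
Qed.

Lemma count_disjoint (p q : pred Y) s : (forall y, p y -> q y -> False) ->
  (count p s + count q s <= size s)%N.
Proof.
move=> pq; elim: s => //= y s IH; have := pq y.
by case: (p y); case: (q y) => h; rewrite ?(h isT isT)//; lia.
Qed.

(* The edges of [a], [b], [c] and [d] crossing [A] are distributed injectively:
   an edge of [sigma a = a c a] starting in [T1] runs through an [a]-edge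
   starting in [T1], a [c]-edge starting in [T0] or an [a]-edge starting in
   [T0], while [sigma b], [sigma c] and [sigma d] use edges starting in [T1]. *)
Lemma small_sigma n : small to A n -> small sigma_action (A `&` T1) n.
Proof.
move=> [la [lb [lc [ld [[Ha Hb Hc Hd] len]]]]].
pose f0 := [seq y <- _ | `[< T0 y >]]; pose f1 := [seq y <- _ | `[< T1 y >]].
have f01 l : (size (f0 l) + size (f1 l) <= size l)%N.
  rewrite /f0 /f1 !size_filter; apply: count_disjoint => y.
  by move=> /asboolP t0 /asboolP t1; exact: T01_disjoint t0 t1.
have f1P s l y : cross to A s `<=` [set` l] -> T1 y -> cross to A s y -> y \in f1 l.
  by move=> sl ty /sl /= yl; rewrite mem_filter yl andbT; apply/asboolP.
have f0P s l y : cross to A s `<=` [set` l] -> T0 y -> cross to A s y -> y \in f0 l.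
  by move=> sl ty /sl /= yl; rewrite mem_filter yl andbT; apply/asboolP.
exists (f1 la ++ [seq to a^-1 y | y <- f0 lc] ++
        [seq to (c * a)^-1 y | y <- f0 la]), (f1 ld), (f1 lb), (f1 lc).
split; last first.
  rewrite !size_cat !size_map.
  by have := f01 la; have := f01 lb; have := f01 lc; have := f01 ld; lia.
split=> y /cross_sigma[t1]; rewrite ?sigma_b ?sigma_c ?sigma_d; try exact: f1P.
rewrite sigma_a /= !mem_cat /cross /= !actM => yc.
have t0 := T0_a t1.
have t0' : T0 (to c (to a y)) by apply: T0_bcd => //; rewrite !inE eqxx orbT.
have [h1|/contrapT h1] := EM (cross to A a y); first by rewrite (f1P _ _ _ Ha t1 h1).
have [h2|/contrapT h2] := EM (cross to A c (to a y)).
  apply/or3P/Or32/mapP; exists (to a y); last by rewrite actK.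
  exact: f0P Hc t0 h2.
apply/or3P/Or33/mapP; exists (to (c * a) y); last by rewrite actK.
by rewrite actM; apply: f0P Ha t0' _; rewrite /cross /=; tauto.
Qed.

End Types.

(** Induction on [i] over all actions and sets. The element at stage [i.+1] lies in [sigma K]; it
    fixes the points untame for [S0], where periods are bounded. Its remaining crossings are those
    of stage [i] for [sigma_action] and the part of [A] cut by [S1], which obeys the same bound
    [n]. *)
Lemma cross_iter : exists k, forall n to A x, span SK x -> commensurated to A ->
  clean to A -> small to A n -> exists M, forall i,
  exists2 l : seq Y, cross to A (iter i sigma (x ^+ (k * n)`!)) `<=` [set` l] &
    (size l <= M)%N.
Proof.
have [k kP] := edges_word S0; exists k => n to A x xK.
have [s sG sE] := Ggen (x ^+ (k * n)`!).
move=> Ac Acl sm; exists (size s * n)%N => i.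
elim: i to A Ac Acl sm => [|i IH] to A Ac Acl sm.
  by rewrite /= sE; exact: cross_word.
have [l lP ls] := IH _ _ (commensurated_sigma Ac) (clean_sigma Ac) (small_sigma Ac sm).
exists l => // y yc; apply: lP; apply/cross_sigma => //; split => //.
have xiK : span SK (iter i sigma x).
  by elim: i {IH yc l ls} => //= i; exact: Ksigma.
set m := iter i.+1 sigma x.
have mS : span S1 m by apply/span_S1; exists (iter i sigma x).
move: yc; rewrite iter_sigmaX -/m; set e := (k * n)`! => yc.
have fixT0 : ~ tame to S0 A y -> to (m ^+ e) y = y.
  move=> t0; have [r r0 mr] := Ktors xiK.
  have mr1 : m ^+ r = 1 by rewrite /m iterS -sigmaX mr sigma1.
  have [E Esize EP] := kP to A n sm.
  have [R [R0 RE Ry]] :=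
    period_bound S0V r0 mr1 (fun g gS => comm01 gS mS) Ac t0 EP.
  (* The factorial is a common multiple of all periods up to [k * n], so one exponent serves every
     point and every stage. *)
  have /dvdnP[q ->] : (R %| e)%N by rewrite dvdn_fact// R0 (leq_trans RE).
  rewrite mulnC expgnA; elim: q => [|q IHq]; first by rewrite act1.
  by rewrite expgS actM IHq.
have [t0|t1] : ~ tame to S0 A y \/ ~ tame to S1 A y; last first.
- by [].
- by case: yc; rewrite fixT0.
(* Cleanness gives a type only to points of [A]. If [y] is outside, its image lies in [A], and
   elements of [sigma K] preserve both types. *)
have [Ay|Ay] := EM (A y); first by apply: T01_typed => //; exact: Acl.
have Amy : A (to (m ^+ e) y).
  by apply: contrapT => h; apply: yc; split => [/Ay|/h].
have [t|t] := T01_typed Ac (Acl _ Amy).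
  by left; apply/(T0_S1 Ac _ (spanX e mS)).
right; apply/(T1_sigma Ac (iter i sigma x ^+ e)).
by rewrite sigmaX.
Qed.


End Action.

Hypothesis sigma_inj : forall x, span SK x -> x <> 1 ->
  injective (fun i => iter i sigma x).
Hypothesis Kexp : forall e, (0 < e)%N -> exists2 k, span SK k & k ^+ e <> 1.

Theorem selfsimilar_not_PW : ~ property_PW G.
Proof.
case=> Y0 [to0 [A0 [fin prop]]].
pose Y : choiceType := {classic Y0}.
pose to : left_action G Y := to0.
pose A : set Y := A0.
have Ac : commensurated to A.
  by move=> g; rewrite -symdiff_cross; exact: fin.
have [A'c A'clean [D DP]] := untame_part GsV Ggen Ac.
set A' := A `&` _ in A'c A'clean DP.
have [la Ha] := (finite_seqP _).1 (A'c a).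
have [lb Hb] := (finite_seqP _).1 (A'c b).
have [lc Hc] := (finite_seqP _).1 (A'c c).
have [ld Hd] := (finite_seqP _).1 (A'c d).
pose n := (size la + size lb + size lc + size ld)%N.
have sm : small to A' n.
  by exists la, lb, lc, ld; split => //; rewrite Ha Hb Hc Hd; split.
have [k kP] := cross_iter Y.
(* The exponent is determined by [A'] before [x] is chosen, so an exponent-dependent [x] is
   enough. *)
have [x xK xe] := Kexp (fact_gt0 (k * n)).
have [M MP] := kP n to A' x xK A'c A'clean sm.
(* Inverses enter because [cross to A g] is the symmetric difference for [g^-1]. *)
apply: (injective_infinite _ _ (prop (M + (size D + size D))%N)).
  by move=> i j /invg_inj; apply: (sigma_inj (spanX _ xK) xe).
move=> i /=; have [l lP ls] := MP i.
set g := iter _ _ _ in lP *.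
apply: (@leq_trans (size (l ++ (D ++ [seq to g^-1 y | y <- D])))).
  apply: (nu_le (fin _)).
  suff : act_symdiff to A g^-1 `<=` [set` l ++ (D ++ [seq to g^-1 y | y <- D])] by [].
  rewrite symdiff_cross => y /DP[/lP /= yl|/= yD].
    by rewrite mem_cat yl.
  by rewrite mem_cat yD orbT.
by rewrite !size_cat size_map leq_add2r.
Qed.

End SelfSimilar.

(** * The word problem of the Grigorchuk group *)

Variant bcd := Lb | Lc | Ld.
Variant letter := La | Lx of bcd.

Definition bcd_mul (x y : bcd) : option bcd :=
  match x, y with
  | Lb, Lb | Lc, Lc | Ld, Ld => None
  | Lb, Lc | Lc, Lb => Some Ld
  | Lb, Ld | Ld, Lb => Some Lc
  | Lc, Ld | Ld, Lc => Some Lb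
  end.

Definition bcd_next (x : bcd) : bcd :=
  match x with Lb => Lc | Lc => Ld | Ld => Lb end.

Definition is_d (x : bcd) : bool := if x is Ld then true else false.

Definition act_letter (l : letter) : word -> word :=
  match l with
  | La => grig_a_fun
  | Lx Lb => grig_b_fun
  | Lx Lc => grig_c_fun
  | Lx Ld => grig_d_fun
  end.

Definition act_word (s : seq letter) (w : word) : word := foldr act_letter w s.

Fixpoint swap (s : seq letter) : bool :=
  match s with
  | [::] => false
  | La :: s' => ~~ swap s'
  | Lx _ :: s' => swap s'
  end.

Definition section_letter (x : bool) (l : letter) : seq letter :=
  match l, x with
  | La, _ => [::]
  | Lx y, true => [:: Lx (bcd_next y)]
  | Lx y, false => if is_d y then [::] else [:: La]
  end.

(** Letters act from right to left, so [l] meets the letter [x (+) swap s'] to which the rest of the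
    word has moved [x]. *)
Fixpoint section (x : bool) (s : seq letter) : seq letter :=
  if s is l :: s' then section_letter (x (+) swap s') l ++ section x s'
  else [::].

Lemma act_word_cat s t w : act_word (s ++ t) w = act_word s (act_word t w).
Proof. by rewrite /act_word foldr_cat. Qed.

Lemma act_word_cons x s w :
  act_word s (x :: w) = x (+) swap s :: act_word (section x s) w.
Proof.
elim: s => [|l s IH] /=; first by rewrite addbF.
rewrite act_word_cat IH; case: l => [|[]]; case: x {IH}; case: (swap s) => //=.
Qed.

Lemma act_letterK l : involutive (act_letter l).
Proof.
case: l => [|[]]; [exact: grig_a_funK|exact: grig_b_funK|exact: grig_c_funK|].
exact: grig_d_funK.
Qed.

Lemma act_word_nil s : act_word s [::] = [::].
Proof. by elim: s => //= -[|[]] s /= ->. Qed.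

Lemma grig_bc w : [/\ grig_b_fun (grig_c_fun w) = grig_d_fun w,
  grig_c_fun (grig_d_fun w) = grig_b_fun w & grig_d_fun (grig_b_fun w) = grig_c_fun w].
Proof.
elim: w => [//|[] w [bc cd db]] /=; first by rewrite cd db bc.
by rewrite grig_a_funK.
Qed.

Lemma bcd_mulP x y w : act_letter (Lx x) (act_letter (Lx y) w) =
  if bcd_mul x y is Some z then act_letter (Lx z) w else w.
Proof.
have [bc cd db] := grig_bc w.
case: x; case: y => /=; rewrite ?grig_b_funK ?grig_c_funK ?grig_d_funK ?bc ?cd ?db//.
- by rewrite -bc grig_b_funK.
- by rewrite -cd grig_c_funK.
- by rewrite -db grig_d_funK.
Qed.

Definition push (l : letter) (s : seq letter) : seq letter :=
  match l, s with
  | La, La :: s' => s'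
  | Lx x, Lx y :: s' => if bcd_mul x y is Some z then Lx z :: s' else s'
  | _, _ => l :: s
  end.

Definition reduce (s : seq letter) : seq letter := foldr push [::] s.

(* The section maps shorten reduced words, so [n] bounds the depth of the
   recursion that decides whether a word acts trivially. *)
Fixpoint trivial_word (n : nat) (s : seq letter) : bool :=
  let r := reduce s in
  nilp r || (if n is n'.+1 then
    [&& ~~ swap r, trivial_word n' (section false r)
      & trivial_word n' (section true r)] else false).

Lemma act_word_push l s w : act_word (push l s) w = act_word (l :: s) w.
Proof.
case: l s => [|x] [|[|y] s] //=; first by rewrite grig_a_funK.
by rewrite -[RHS]/(act_letter (Lx x) (act_letter (Lx y) _)) bcd_mulP; case: bcd_mul.
Qed.

Lemma act_word_reduce s w : act_word (reduce s) w = act_word s w.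
Proof. by elim: s => //= l s IH; rewrite act_word_push /= IH. Qed.

Lemma trivial_wordP n s : trivial_word n s -> forall w, act_word s w = w.
Proof.
elim: n s => [|n IH] s + w; rewrite -(act_word_reduce s w) /=.
  by rewrite orbF => /nilP->.
case/orP=> [/nilP->//|/and3P[sw /IH t0 /IH t1]].
case: w => [|x w]; first by rewrite act_word_nil.
by rewrite act_word_cons (negbTE sw) addbF; congr (_ :: _); case: x.
Qed.

Lemma act_word_rev s : cancel (act_word s) (act_word (rev s)).
Proof.
elim: s => [|l s IH] w //.
by rewrite rev_cons -cats1 act_word_cat /= act_letterK IH.
Qed.

Lemma act_word_eq n s t : trivial_word n (s ++ rev t) ->
  forall w, act_word s w = act_word t w.
Proof.
move=> /trivial_wordP h w.
by have := h (act_word t w); rewrite act_word_cat act_word_rev.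
Qed.

(** * Words as elements of the group *)

Definition grig_letter (l : letter) : tree_aut :=
  match l with
  | La => grig_a
  | Lx Lb => grig_b
  | Lx Lc => grig_c
  | Lx Ld => grig_d
  end.

Lemma in_grig_letter l : in_grigorchuk (grig_letter l).
Proof.
apply/asboolP => H _ HS; apply: HS.
by case: l => [|[]] /=; [apply: Or41|apply: Or42|apply: Or43|apply: Or44].
Qed.

Definition gen (l : letter) : grigorchuk := Grigorchuk (in_grig_letter l).

Definition ev (s : seq letter) : grigorchuk := foldr *%g 1 (map gen s).

Lemma grigM (g h : grigorchuk) w : (g * h) w = g (h w).
Proof. by []. Qed.

Lemma grig1 w : (1 : grigorchuk) w = w.
Proof. by []. Qed.

Lemma grig_ext (g h : grigorchuk) : (forall w, g w = h w) -> g = h.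
Proof. by move=> gh; apply/val_inj/tree_aut_ext. Qed.

Lemma genE l w : gen l w = act_letter l w.
Proof. by case: l => [|[]]. Qed.

Lemma evE s w : ev s w = act_word s w.
Proof.
by elim: s => [//|l s IH]; rewrite -[LHS]/(gen l (ev s w)) genE IH.
Qed.

Lemma ev_cat s t : ev (s ++ t) = ev s * ev t.
Proof. by elim: s => [|l s IH] /=; rewrite ?mul1g// /ev /= -mulgA -IH. Qed.

Lemma ev_eq n s t : trivial_word n (s ++ rev t) -> ev s = ev t.
Proof. by move=> /act_word_eq h; apply: grig_ext => w; rewrite !evE. Qed.

Lemma genV l : (gen l)^-1 = gen l.
Proof.
apply: (mulgI (gen l)); rewrite mulgV; apply: grig_ext => w.
by rewrite grigM !genE act_letterK.
Qed.

Lemma evV s : (ev s)^-1 = ev (rev s).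
Proof.
apply: (mulgI (ev s)); rewrite mulgV -ev_cat; apply: grig_ext => w.
by rewrite evE act_word_cat -{1}[s]revK act_word_rev.
Qed.

Lemma grig_word (g : grigorchuk) : exists s, g = ev s.
Proof.
case: g => g gG; pose P := [pred x : tree_aut | `[< exists s, x = ev s >]].
have : g \in P.
  move/asboolP: (gG); apply.
    split=> [|x y]; rewrite !inE; first by exists [::].
    by move=> [s ->] [t ->]; exists (s ++ rev t); rewrite ev_cat -evV.
  move=> s sG; rewrite inE.
  case: sG => ->; [exists [:: La]|exists [:: Lx Lb]|exists [:: Lx Lc]|exists [:: Lx Ld]];
    by apply: tree_aut_ext.
by rewrite inE => -[s gs]; exists s; apply: val_inj.
Qed.

(** * The substitution and the branching subgroup *)

Definition sigma_letter (l : letter) : seq letter :=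
  match l with
  | La => [:: La; Lx Lc; La]
  | Lx Lb => [:: Lx Ld]
  | Lx Lc => [:: Lx Lb]
  | Lx Ld => [:: Lx Lc]
  end.

Definition sigma_word (s : seq letter) : seq letter :=
  flatten (map sigma_letter s).

(* The section of [sigma_word s] at the letter 0; the one at 1 is [s]. *)
Definition pi_letter (l : letter) : seq letter :=
  match l with
  | La => [:: Lx Ld]
  | Lx Lb => [::]
  | Lx _ => [:: La]
  end.

Definition pi_word (s : seq letter) : seq letter := flatten (map pi_letter s).

Lemma swap_cat s t : swap (s ++ t) = swap s (+) swap t.
Proof. by elim: s => //= -[|x] s ->; rewrite ?addNb. Qed.

Lemma swap_sigma s : swap (sigma_word s) = false.
Proof.
elim: s => //= l s IH; rewrite /sigma_word /= swap_cat -/(sigma_word s) IH.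
by case: l => [|[]].
Qed.

Lemma section_cat x s t : section x (s ++ t) = section (x (+) swap t) s ++ section x t.
Proof.
elim: s => //= l s ->; rewrite swap_cat catA.
by rewrite (addbC (swap s)) addbA.
Qed.

Lemma section_sigma s : section true (sigma_word s) = s /\
  section false (sigma_word s) = pi_word s.
Proof.
elim: s => //= l s [IH1 IH0]; rewrite /sigma_word /= -/(sigma_word s).
by rewrite !section_cat swap_sigma IH1 IH0; case: l => [|[]].
Qed.

Lemma act_sigma_word s w :
  act_word (sigma_word s) (true :: w) = true :: act_word s w /\
  act_word (sigma_word s) (false :: w) = false :: act_word (pi_word s) w.
Proof. by have [e1 e0] := section_sigma s; rewrite !act_word_cons swap_sigma e1 e0. Qed.

Definition is_letter (y : bcd) (l : letter) : bool :=
  match y, l with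
  | Lb, Lx Lb | Lc, Lx Lc | Ld, Lx Ld => true
  | _, _ => false
  end.

Fixpoint parity (y : bcd) (s : seq letter) : bool :=
  if s is l :: s' then is_letter y l (+) parity y s' else false.

Lemma parity_cat y s t : parity y (s ++ t) = parity y s (+) parity y t.
Proof. by elim: s => //= l s ->; rewrite addbA. Qed.

(** Each b contributes an a to one section and a c to the other, each c an a and a d, each d only a
    b; the identities count letters modulo 2 over both sections. *)
Lemma section_parity s :
  [/\ swap (section false s) (+) swap (section true s) = parity Lb s (+) parity Lc s,
      parity Lb (section false s) (+) parity Lb (section true s) = parity Ld s &
      parity Lc (section false s) (+) parity Lc (section true s) = parity Lb s].
Proof.
elim: s => //= l s [IHa IHb IHc].
rewrite !swap_cat !parity_cat -!IHb -!IHc.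
have {IHa} : parity Lc s = swap (section false s) (+) swap (section true s) (+)
    (parity Lc (section false s) (+) parity Lc (section true s)).
  by rewrite IHa IHc addbC addbA addbb.
move: (swap (section false s)) (swap (section true s)) (parity Lc s).
move: (parity Lb (section false s)) (parity Lb (section true s)).
move: (parity Lc (section false s)) (parity Lc (section true s)).
by case: l (swap s) => [|[]] [] [] [] [] [] [] [] [].
Qed.

(** The homomorphism to the group of order 2 that kills a and c but not b and d; [psi_trivial] shows
    that it is well defined on the group. *)
Definition psi (s : seq letter) : bool := parity Lb s (+) parity Ld s.

Definition acts_trivially (s : seq letter) : Prop := forall w, act_word s w = w.

Lemma acts_trivially_section s : acts_trivially s ->
  swap s = false /\ forall x, acts_trivially (section x s).
Proof.
move=> ts; have sw : swap s = false.
  by have := ts [:: false]; rewrite act_word_cons => -[].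
by split=> // x w; have := ts (x :: w); rewrite act_word_cons sw addbF => -[].
Qed.

(** By [section_parity], [psi s] sums the parities of b and c in the two sections, and these are
    sums of [swap] over second-level sections, which all vanish. *)
Lemma psi_trivial s : acts_trivially s -> psi s = false.
Proof.
move=> /acts_trivially_section[_ ts].
have [_ e1 e2] := section_parity s; rewrite /psi -e1 -e2.
have level x : parity Lb (section x s) (+) parity Lc (section x s) = false.
  have [<- _ _] := section_parity (section x s).
  have [_ t] := acts_trivially_section (ts x).
  by rewrite (acts_trivially_section (t false)).1 (acts_trivially_section (t true)).1.
have := level false; have := level true.
by do 4! case: parity.
Qed.

(* The normal form of [pi_word s] in the dihedral group generated by [a] and
   [d], which is the wreath product of two groups of order 2. *)
Definition dihedral (e x y : bool) : seq letter :=
  nseq e (Lx Ld) ++ (if x then [:: Lx Ld; La; Lx Ld] else [::]) ++ nseq y La.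

Lemma pi_dihedral s w : act_word (pi_word s) w =
  act_word (dihedral (swap s) (psi (section false s)) (psi (section true s))) w.
Proof.
elim: s w => [|l s IH] w //; rewrite /pi_word /= act_word_cat IH -act_word_cat.
apply: (@act_word_eq 4); rewrite /psi !parity_cat.
move: (parity Lb (section false s)) (parity Ld (section false s)).
move: (parity Lb (section true s)) (parity Ld (section true s)).
by case: l (swap s) => [|[]] [] [] [] [] [].
Qed.

(** Below 0 the substituted word acts as [pi_word s], whose dihedral normal form depends only on
    invariants that vanish for trivially acting words. So the substitution respects the
    relations. *)
Lemma sigma_trivial s : acts_trivially s -> acts_trivially (sigma_word s).
Proof.
move=> ts; have [sw tx] := acts_trivially_section ts.
case=> [|[] w]; first exact: act_word_nil.
  by rewrite (act_sigma_word s w).1 ts.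
by rewrite (act_sigma_word s w).2 pi_dihedral sw !psi_trivial.
Qed.

Lemma sigma_word_cat s t : sigma_word (s ++ t) = sigma_word s ++ sigma_word t.
Proof. by rewrite /sigma_word map_cat flatten_cat. Qed.

Lemma sigma_word_rev s : sigma_word (rev s) = rev (sigma_word s).
Proof.
elim: s => // l s IH; rewrite rev_cons -cats1 sigma_word_cat IH.
rewrite -[l :: s]/([:: l] ++ s) sigma_word_cat rev_cat.
by congr (_ ++ _); case: l => [|[]].
Qed.

Definition word_of (g : grigorchuk) : seq letter := sval (cid (grig_word g)).

Lemma word_ofK : cancel word_of ev.
Proof. by move=> g; rewrite /word_of; case: cid => /= s ->. Qed.

Definition sigma (g : grigorchuk) : grigorchuk := ev (sigma_word (word_of g)).

(** Independence of the chosen word: two words for one element differ by a trivially acting word,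
    and substitution commutes with concatenation and reversal. *)
Lemma sigma_ev s : sigma (ev s) = ev (sigma_word s).
Proof.
apply: (mulIg (ev (sigma_word s))^-1); rewrite mulgV /sigma evV -ev_cat.
rewrite -sigma_word_rev -sigma_word_cat; apply: grig_ext => w; rewrite evE.
apply: sigma_trivial => {}w; rewrite -evE ev_cat word_ofK -evV.
by rewrite mulgV.
Qed.

Lemma sigmaM : {morph sigma : g h / g * h}.
Proof.
move=> g h; rewrite -(word_ofK g) -(word_ofK h) -ev_cat !sigma_ev.
by rewrite sigma_word_cat ev_cat.
Qed.

Lemma sigma_true g w : sigma g (true :: w) = true :: g w.
Proof. by rewrite -{2}(word_ofK g) !evE (act_sigma_word _ w).1. Qed.

(* With [t = (ab)^2], these are [t], [(t, 1)] and [(1, t)]. *)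
Definition word_t := [:: La; Lx Lb; La; Lx Lb].
Definition word_t0 := [:: Lx Lb; La; Lx Ld; La; Lx Lb; La; Lx Ld; La].
Definition word_t1 := [:: La; Lx Lb; La; Lx Ld; La; Lx Lb; La; Lx Ld].

Definition K_words : seq (seq letter) :=
  [:: word_t; rev word_t; word_t0; rev word_t0; word_t1; rev word_t1].

Definition K_gens : seq grigorchuk := map ev K_words.

Definition K_eval (p : seq nat) : seq letter :=
  flatten [seq nth [::] K_words i | i <- p].

(** The list [p] spells a product of members of [K_words] claimed to equal [s]. The number 20 is
    recursion depth; too small a value could only make the check fail. *)
Definition K_cert (s : seq letter) (p : seq nat) : bool :=
  trivial_word 20 (s ++ rev (K_eval p)).

Lemma K_certP s p : K_cert s p -> span K_gens (ev s).
Proof.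
rewrite /K_cert => /(@ev_eq 20 s (K_eval p)) ->.
elim: p => [|i p IH]; first exact: span1.
rewrite /K_eval /= ev_cat; apply: spanM => //.
have [lt|ge] := ltnP i (size K_words).
  apply: span_gen; apply/(nthP 1); exists i; first by rewrite size_map.
  by rewrite (nth_map [::]).
by rewrite nth_default//; exact: span1.
Qed.

Lemma K_gensV : closed_inv K_gens.
Proof.
move=> s /(nthP 1)[i]; rewrite size_map => isz <- {s}; rewrite (nth_map [::])// evV.
(* [K_words] lists each word at an even position, directly followed by its reverse. *)
apply/(nthP 1); exists (if odd i then i.-1 else i.+1).
  by case: i isz => [|[|[|[|[|[|i]]]]]].
by case: i isz => [|[|[|[|[|[|i]]]]]].
Qed.

Lemma K_gensP (P : grigorchuk -> Prop) :
  (forall s, List.In s K_words -> P (ev s)) -> forall g, g \in K_gens -> P g.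
Proof.
move=> Ps g; rewrite /K_gens; elim: K_words Ps => //= s ss IH Ps.
rewrite inE => /predU1P[->|]; first by apply: Ps; left.
by apply: IH => t st; apply: Ps; right.
Qed.

Definition Gs := [:: gen La; gen (Lx Lb); gen (Lx Lc); gen (Lx Ld)].

Lemma gen_span g : span Gs g.
Proof.
have [s ->] := grig_word g; elim: s => [|l s IH]; first exact: span1.
by apply: span_consM => //; rewrite !inE; case: l => [|[]]; rewrite eqxx ?orbT.
Qed.

Lemma GsV : closed_inv Gs.
Proof. by move=> s; rewrite !inE => /or4P[]/eqP->; rewrite genV eqxx ?orbT. Qed.

(* Lists of positions in [K_words], found by computer search. *)
Definition conj_cert (l : letter) (i : nat) : seq nat :=
  match l, i with
  | Lx Lc, 0 => [:: 1; 4]%N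
  | Lx Ld, 0 => [:: 5; 0]%N
  | _, 0 => [:: 1]%N
  | La, 2 => [:: 4]%N
  | Lx Ld, 2 => [:: 2]%N
  | _, 2 => [:: 3]%N
  | La, _ => [:: 2]%N
  | Lx Lb, _ => [:: 1; 5; 0]%N
  | Lx Lc, _ => [:: 1; 4; 0]%N
  | Lx Ld, _ => [:: 5]%N
  end.

Lemma conj_mulr (G : groupType) (g x y : G) :
  g * (x * y) * g^-1 = (g * x * g^-1) * (g * y * g^-1).
Proof. by rewrite !mulgA mulgVK. Qed.

Lemma conj_K l s : List.In s K_words ->
  span K_gens (gen l * ev s * (gen l)^-1).
Proof.
have conj_word i : i \in [:: 0; 2; 4]%N ->
    span K_gens (gen l * ev (nth [::] K_words i) * (gen l)^-1).
  rewrite genV => i024; have -> : gen l * ev (nth [::] K_words i) * gen l =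
      ev ([:: l] ++ nth [::] K_words i ++ [:: l]).
    by rewrite !ev_cat /ev /= !mulg1 mulgA.
  apply: (@K_certP _ (conj_cert l i)); move: i024; rewrite !inE.
  by case/or3P => /eqP->; case: l => [|[]].
have conj_rev s' : span K_gens (gen l * ev s' * (gen l)^-1) ->
    span K_gens (gen l * ev (rev s') * (gen l)^-1).
  move=> /(spanV K_gensV); rewrite -evV !invgM invgK mulgA.
  by [].
case=> [<-|[<-|[<-|[<-|[<-|[<-|[]]]]]]].
- exact: (conj_word 0).
- exact/conj_rev/(conj_word 0).
- exact: (conj_word 2).
- exact/conj_rev/(conj_word 2).
- exact: (conj_word 4).
- exact/conj_rev/(conj_word 4).
Qed.

Lemma K_normal g k : span K_gens k -> span K_gens (g * k * g^-1).
Proof.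
move: k; elim/span_ind: g / (gen_span g) => [|s g sG _ IH] k kK.
  by rewrite mul1g invg1 mulg1.
rewrite conj_mul; move: (IH k kK); move: (g * k * g^-1) => {kK IH}k kK.
have {sG}[l ->] : exists l, s = gen l.
  by move: sG; rewrite !inE => /or4P[]/eqP->; eexists.
elim/span_ind: k / kK => [|x k xK _ IH]; first by rewrite mulg1 mulgV; exact: span1.
rewrite conj_mulr; apply: spanM => //; move: x xK.
by apply: K_gensP => s' /conj_K; apply.
Qed.

Lemma K_sigma k : span K_gens k -> span K_gens (sigma k).
Proof.
have sigma_1 : sigma 1 = 1 by rewrite -[1]/(ev [::]) sigma_ev.
elim/span_ind=> [|x {}k xK _ IH]; first by rewrite sigma_1; exact: span1.
rewrite sigmaM; apply: spanM => //; move: x xK; apply: K_gensP => s.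
rewrite sigma_ev; case=> [<-|[<-|[<-|[<-|[<-|[<-|[]]]]]]].
- exact: (@K_certP _ [:: 4]%N).
- exact: (@K_certP _ [:: 5]%N).
- exact: (@K_certP _ [:: 5; 0; 4; 1]%N).
- exact: (@K_certP _ [:: 0; 5; 1; 4]%N).
- exact: (@K_certP _ [:: 4; 1; 5; 0]%N).
- exact: (@K_certP _ [:: 1; 4; 0; 5]%N).
Qed.

(** With [sigma_true] this says that [sigma k] is [(1, k)]: [pi_word] sends each generator of K to a
    trivially acting word. *)
Lemma K_false k w : span K_gens k -> sigma k (false :: w) = false :: w.
Proof.
move=> kK; elim/span_ind: k / kK w => [|x k xK _ IH] w.
  by rewrite -[1]/(ev [::]) sigma_ev.
rewrite sigmaM grigM IH; move: x xK; apply: K_gensP => s.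
rewrite sigma_ev evE (act_sigma_word s w).2 => sK; congr (_ :: _).
apply: (@trivial_wordP 20).
by case: sK => [<-|[<-|[<-|[<-|[<-|[<-|[]]]]]]].
Qed.

Lemma act_gen_a x w : gen La (x :: w) = ~~ x :: w.
Proof. by []. Qed.

(** The two elements are supported on the disjoint subtrees at 1 and at 0. *)
Lemma K_comm k k' : span K_gens k -> span K_gens k' ->
  commute (sigma k) (gen La * sigma k' * (gen La)^-1).
Proof.
move=> kK k'K; rewrite genV; apply: grig_ext => -[|[] w].
- by rewrite !aut_root.
all: by do 6! rewrite ?grigM ?act_gen_a ?sigma_true ?K_false //=.
Qed.

(** [ada] acts as b below 0 and trivially below 1, where [sigma k] is supported. *)
Lemma K_comm_d k : span K_gens k ->
  commute (sigma k) (gen La * gen (Lx Ld) * gen La).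
Proof.
move=> kK; apply: grig_ext => -[|[] w].
- by rewrite !aut_root.
all: by do 6! rewrite ?grigM ?act_gen_a ?sigma_true ?K_false //=.
Qed.

(** * Torsion *)

Definition torsion (G : groupType) (g : G) : Prop :=
  exists2 r, (0 < r)%N & g ^+ r = 1.

Lemma conj_expg (G : groupType) (g h : G) r :
  (g * h * g^-1) ^+ r = g * h ^+ r * g^-1.
Proof.
elim: r => [|r IH]; first by rewrite mulg1 mulgV.
by rewrite !expgS IH conj_mulr.
Qed.

Lemma torsion_mulC (G : groupType) (g h : G) : torsion (g * h) -> torsion (h * g).
Proof.
case=> r r0 gr; exists r => //.
have -> : h * g = h * (g * h) * h^-1 by rewrite !mulgA mulgK.
by rewrite conj_expg gr mulg1 mulgV.
Qed.

Lemma torsion_involution (G : groupType) (g : G) : g * g = 1 -> torsion g.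
Proof. by move=> gg; exists 2; rewrite // expg2. Qed.

Definition tor (s : seq letter) : Prop := torsion (ev s).

Lemma tor_cat s t : tor (s ++ t) -> tor (t ++ s).
Proof. by rewrite /tor !ev_cat; exact: torsion_mulC. Qed.

Lemma tor_gen l : tor [:: l].
Proof.
apply: torsion_involution; rewrite -ev_cat.
by apply: (@ev_eq 1 _ [::]); case: l => [|[]].
Qed.

(** Each pair is a block, an optional a followed by one of b, c, d; by [word_pair] every element has
    this form up to a trailing a. *)
Definition pair_word (ps : seq (bool * bcd)) : seq letter :=
  flatten [seq nseq (p.1 : bool) La ++ [:: Lx p.2] | p <- ps].

Lemma pair_word_cat ps qs : pair_word (ps ++ qs) = pair_word ps ++ pair_word qs.
Proof. by rewrite /pair_word map_cat flatten_cat. Qed.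

Lemma has_split (T : Type) (a : pred T) s : has a s ->
  exists s1 x s2, s = s1 ++ x :: s2 /\ a x.
Proof.
elim: s => //= x s IH /orP[ax|/IH[s1 [y [s2 [-> ay]]]]].
  by exists [::], x, s.
by exists (x :: s1), y, s2.
Qed.

Lemma ev_nseq_addb (e f : bool) s :
  ev (nseq e La ++ nseq f La ++ s) = ev (nseq (e (+) f) La ++ s).
Proof.
rewrite catA !(ev_cat _ s); congr (_ * _); apply: (@ev_eq 2).
by case: e; case: f.
Qed.

Lemma tor_nseq_a (e : bool) : tor (nseq e La).
Proof. by case: e; [exact: tor_gen|exists 1%N]. Qed.

(** A block without a puts two of the letters b, c, d side by side cyclically. Multiplying them
    leaves, up to conjugation, a word with fewer blocks, a single generator or the empty word. *)
Lemma tor_merge ps : (forall qs, (size qs < size ps)%N -> tor (pair_word qs)) ->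
  has (fun p => ~~ p.1) ps -> tor (pair_word ps).
Proof.
move=> IH /has_split[p1 [[e x] [p2 [psE /= /negbTE ex]]]]; subst e.
have {}IH qs : (size qs <= size (p2 ++ p1))%N -> tor (pair_word qs).
  by move=> le; apply: IH; rewrite psE !size_cat /= in le *; lia.
rewrite psE pair_word_cat; apply: tor_cat.
have -> : pair_word ((false, x) :: p2) ++ pair_word p1 = Lx x :: pair_word (p2 ++ p1).
  by rewrite pair_word_cat.
case/lastP: (p2 ++ p1) IH => [|q [e y]] IH; first exact: tor_gen.
rewrite -cats1 pair_word_cat.
have -> : pair_word [:: (e, y)] = nseq e La ++ [:: Lx y] by rewrite /pair_word /= cats0.
rewrite catA -cat_cons; apply: tor_cat.
have -> (s : seq letter) : tor ([:: Lx y] ++ Lx x :: s) =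
    tor ((if bcd_mul y x is Some z then [:: Lx z] else [::]) ++ s).
  rewrite -[_ ++ Lx x :: s]/([:: Lx y; Lx x] ++ s) /tor !(ev_cat _ s).
  congr (torsion (_ * _)).
  by apply: (@ev_eq 1); case: x {psE}; case: y {IH}.
case: bcd_mul => [z|]; apply: tor_cat.
  rewrite -catA; have -> : pair_word q ++ nseq e La ++ [:: Lx z] = pair_word (rcons q (e, z)).
    by rewrite -cats1 pair_word_cat [pair_word [:: _]]/pair_word /= cats0.
  by apply: IH; rewrite !size_rcons.
rewrite cats0; apply: tor_cat; case: q IH => [|[f u] q] IH.
  by rewrite cats0; exact: tor_nseq_a.
rewrite /tor /pair_word /= -catA ev_nseq_addb.
rewrite catA; apply: (IH ((e (+) f, u) :: q)).
by rewrite size_rcons /=; lia.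
Qed.

Definition alt_word (xs : seq bcd) : seq letter :=
  pair_word [seq (true, x) | x <- xs].

Fixpoint alt_section (xs : seq bcd) : seq (bool * bcd) :=
  if xs is x :: y :: xs' then (~~ is_d x, bcd_next y) :: alt_section xs' else [::].

Lemma seq_ind2 (T : Type) (P : seq T -> Prop) : P [::] -> (forall x, P [:: x]) ->
  (forall x y s, P s -> P (x :: y :: s)) -> forall s, P s.
Proof.
move=> P0 P1 P2 s; have [n] := ubnP (size s); elim: n s => // n IH.
by case=> [|x [|y s]] //= ns; apply/P2/IH; lia.
Qed.

Lemma swap_alt xs : swap (alt_word xs) = odd (size xs).
Proof. by elim: xs => //= x xs <-. Qed.

Lemma section_alt xs : ~~ odd (size xs) ->
  section true (alt_word xs) = pair_word (alt_section xs).
Proof.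
elim/seq_ind2: xs => // x y xs IH; rewrite [size _]/= !oddS negbK => even.
rewrite -[alt_word _]/([:: La; Lx x; La; Lx y] ++ alt_word xs) section_cat.
by rewrite swap_alt (negbTE even) IH//; case: x.
Qed.

Lemma size_alt_section xs : size (alt_section xs) = (size xs)./2.
Proof. by elim/seq_ind2: xs => //= x y xs ->. Qed.

Lemma iter_section (g h : grigorchuk) : (forall w, g (true :: w) = true :: h w) ->
  forall r w, (g ^+ r : grigorchuk) (true :: w) = true :: (h ^+ r : grigorchuk) w.
Proof.
move=> gh; elim=> [|r IH] w //.
by rewrite !expgS !grigM IH gh.
Qed.

(* Conjugation by [a x] exchanges the two subtrees and rotates the word. *)
Lemma tor_alt_even xs : ~~ odd (size xs) ->
  tor (pair_word (alt_section xs)) -> tor (pair_word (alt_section (rot 1 xs))) ->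
  tor (alt_word xs).
Proof.
move=> even [r r0 hr] [r' r'0 hr'].
have sect ys : ~~ odd (size ys) -> forall w,
    ev (alt_word ys) (true :: w) = true :: ev (pair_word (alt_section ys)) w.
  move=> ev_ys w; rewrite !evE act_word_cons swap_alt (negbTE ev_ys).
  by rewrite section_alt.
have fix1 m w : (ev (alt_word xs) ^+ (r * m) : grigorchuk) (true :: w) = true :: w.
  by rewrite (iter_section (sect _ even)) expgnA hr expg1n.
case: xs even hr hr' sect fix1 => [|x xs] even hr hr' sect fix1; first by exists 1%N.
exists (r * r')%N; first by rewrite muln_gt0 r0.
apply: grig_ext => -[|[] w]; first by rewrite aut_root.
  exact: fix1.
pose u := ev [:: La; Lx x].
have rotE : ev (alt_word (x :: xs)) = u * ev (alt_word (rot 1 (x :: xs))) * u^-1.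
  rewrite rot1_cons -cats1 /alt_word map_cat pair_word_cat.
  rewrite ev_cat mulgA -ev_cat -[pair_word (map _ [:: x])]/([:: La; Lx x]) -/u.
  by rewrite mulgK.
have [w' uw] : exists w', (u^-1 : grigorchuk) (false :: w) = true :: w'.
  by rewrite /u evV evE; case: x {even hr hr' sect fix1 u rotE}; eexists.
have even' : ~~ odd (size (rot 1 (x :: xs))) by rewrite size_rot.
rewrite rotE conj_expg !grigM uw (iter_section (sect _ even')).
rewrite mulnC expgnA hr' expg1n grig1 -uw.
by rewrite -[LHS]/((u * u^-1 : grigorchuk) (false :: w)) mulgV.
Qed.

Fixpoint evens (T : Type) (s : seq T) : seq T :=
  if s is x :: y :: s' then x :: evens s' else s.

Fixpoint odds (T : Type) (s : seq T) : seq T :=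
  if s is x :: y :: s' then y :: odds s' else [::].

Lemma alt_sectionE xs : ~~ odd (size xs) ->
  alt_section xs = zip [seq ~~ is_d x | x <- evens xs] [seq bcd_next x | x <- odds xs].
Proof.
by elim/seq_ind2: xs => //= x y xs IH; rewrite negbK => /IH ->.
Qed.

Lemma evens_odds_cons (T : Type) (x : T) s :
  evens (x :: s) = x :: odds s /\ odds (x :: s) = evens s.
Proof.
elim/seq_ind2: s x => //= y z s IH x.
by have [-> ->] := IH z.
Qed.

Lemma evens_cat (T : Type) (s t : seq T) : odd (size s) ->
  evens (s ++ t) = evens s ++ odds t /\ odds (s ++ t) = odds s ++ evens t.
Proof.
elim/seq_ind2: s => // [x _|x y s IH]; first exact: evens_odds_cons.
by rewrite /= negbK => /IH[-> ->].
Qed.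

Lemma has_evens_odds (T : Type) (p : pred T) s :
  has p s = has p (evens s) || has p (odds s).
Proof.
elim/seq_ind2: s => //= [x|x y s ->]; first by rewrite !orbF.
by rewrite -orbA; congr (_ || _); rewrite orbCA.
Qed.

Lemma size_evens_odds (T : Type) (s : seq T) : (size (evens s) + size (odds s) = size s)%N.
Proof. by elim/seq_ind2: s => //= x y s <-; rewrite addnS. Qed.

Lemma zip_no_d (us zs : seq bcd) : size us = size zs -> ~~ has is_d us ->
  zip [seq ~~ is_d x | x <- us] zs = [seq (true, z) | z <- zs].
Proof.
elim: us zs => [|u us IH] [|z zs] //= [] eqs; rewrite negb_or => /andP[-> nd].
by rewrite IH.
Qed.

Section OddLength.
Variable n : nat.
Hypothesis IHn : forall qs, (size qs < n)%N -> tor (pair_word qs).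

Lemma tor_pair_n qs : size qs = n -> has (fun p => ~~ p.1) qs -> tor (pair_word qs).
Proof. by move=> qn; apply: tor_merge; rewrite qn. Qed.

Let T (p : pred bcd) := forall xs, size xs = n -> odd n -> has p xs ->
  tor (alt_word xs).

(** In a doubled word of odd length each letter appears once at an even and once at an odd
    position. *)
Lemma alt_section_double xs : odd (size xs) ->
  exists us vs, [/\ alt_section (xs ++ xs) =
      zip [seq ~~ is_d x | x <- us] [seq bcd_next x | x <- vs],
    size us = size xs, size vs = size xs,
    forall p, has p us = has p xs & forall p, has p vs = has p xs].
Proof.
move=> xo; exists (evens xs ++ odds xs), (odds xs ++ evens xs).
have [e1 e2] := evens_cat xs xo; rewrite -e1 -e2 alt_sectionE; last first.
  by rewrite size_cat oddD xo.
split=> // [||p|p]; rewrite ?e1 ?e2 ?size_cat ?has_cat.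
- exact: size_evens_odds.
- by rewrite addnC size_evens_odds.
- by rewrite -has_evens_odds.
- by rewrite orbC -has_evens_odds.
Qed.

Lemma tor_alt_odd (p : pred bcd) :
  (forall xs, size xs = n -> odd n -> has p xs ->
    tor (pair_word (alt_section (xs ++ xs)))) -> T p.
Proof.
move=> Tp xs xn no xp.
have : tor (alt_word (xs ++ xs)).
  apply: tor_alt_even; first by rewrite size_cat oddD xn no.
    exact: Tp.
  have -> : rot 1 (xs ++ xs) = rot 1 xs ++ rot 1 xs.
    by case: xs {xn xp} => // x xs; rewrite cat_cons !rot1_cons -!cats1 -!catA.
  by apply: Tp; rewrite ?size_rot ?has_rot.
rewrite /tor /alt_word map_cat pair_word_cat ev_cat => -[r r0 xr].
by exists (2 * r)%N; rewrite ?muln_gt0// expgnA.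
Qed.

Lemma tor_alt_d : T is_d.
Proof.
apply: tor_alt_odd => xs xn no xd.
have xo : odd (size xs) by rewrite xn.
have [us [vs [-> su sv hu hv]]] := alt_section_double xo.
apply: tor_pair_n; first by rewrite size_zip !size_map su sv minnn.
rewrite -(has_map fst); rewrite -/unzip1 unzip1_zip ?size_map ?su ?sv//.
by rewrite has_map (eq_has (a2 := is_d)) ?hu// => x /=; rewrite negbK.
Qed.

(** The section of the square has [n] blocks again, so length does not descend. If a d occurs, some
    block lacks its a and merging applies; otherwise the section is alternating with letters
    advanced by [bcd_next], and at most two such steps produce a d. *)
Lemma tor_alt_step p : T p -> T (fun x => p (bcd_next x)).
Proof.
move=> Tp; apply: tor_alt_odd => xs xn no xp.
have xo : odd (size xs) by rewrite xn.
have [us [vs [-> su sv hu hv]]] := alt_section_double xo.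
have [d|nd] := boolP (has is_d us).
  apply: tor_pair_n; first by rewrite size_zip !size_map su sv minnn.
  rewrite -(has_map fst); rewrite -/unzip1 unzip1_zip ?size_map ?su ?sv//.
  by rewrite has_map (eq_has (a2 := is_d)) => // x /=; rewrite negbK.
rewrite zip_no_d ?size_map ?su ?sv//; apply: Tp; rewrite ?size_map ?sv//.
by rewrite has_map -[has _ _]/(has (fun x => p (bcd_next x)) vs) hv.
Qed.

Lemma tor_alt_n xs : size xs = n -> odd n -> tor (alt_word xs).
Proof.
have Tc := tor_alt_step tor_alt_d; have Tb := tor_alt_step Tc.
case: xs => [<-//|[] xs] xn no; [exact: Tb|exact: Tc|exact: tor_alt_d].
Qed.

End OddLength.

(** Strong induction on the number of blocks: a block without a is merged, even alternating words
    have sections with half as many blocks, and odd ones are settled by [tor_alt_n]. *)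
Lemma tor_pair_word ps : tor (pair_word ps).
Proof.
have [n] := ubnP (size ps); elim: n ps => // n IH ps; rewrite ltnS => psn.
have {psn}IH qs : (size qs < size ps)%N -> tor (pair_word qs).
  by move=> lt; apply: IH; exact: leq_trans psn.
have [/tor_merge|all1] := boolP (has (fun p => ~~ p.1) ps); first exact.
have -> : pair_word ps = alt_word [seq p.2 | p <- ps].
  congr pair_word; elim: ps all1 {IH} => //= -[e x] ps IHps /=.
  by rewrite negb_or negbK => /andP[-> /IHps <-].
have [o|e] := boolP (odd (size ps)).
  by apply: (tor_alt_n IH) => //; rewrite size_map.
case: ps IH all1 e => [_ _ _|p ps IH _ e]; first by exists 1%N.
have half : ((size (p :: ps))./2 < size (p :: ps))%N by rewrite ltn_half_double -addnn /=; lia.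
apply: tor_alt_even; rewrite ?size_map//; apply: IH.
all: by rewrite size_alt_section ?size_rot size_map.
Qed.

Lemma word_pair s : exists ps (e : bool), ev s = ev (pair_word ps ++ nseq e La).
Proof.
elim: s => [|l s [ps [e sE]]]; first by exists [::], false.
rewrite -[ev (l :: s)]/(gen l * ev s) sE -[_ * _]/(ev (l :: _)).
case: l => [|x]; last by exists ((false, x) :: ps), e.
case: ps {sE} => [|[f x] ps].
  exists [::], (~~ e); have := ev_nseq_addb true e [::].
  by rewrite !cats0.
exists ((~~ f, x) :: ps), e.
have := ev_nseq_addb true f ([:: Lx x] ++ pair_word ps ++ nseq e La).
by rewrite /pair_word /= -!catA.
Qed.

Lemma grigorchuk_torsion (g : grigorchuk) : torsion g.
Proof.
have [s ->] := grig_word g; have [ps [e ->]] := word_pair s.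
apply: (@tor_cat (nseq e La)); case: ps => [|[f x] ps].
  by rewrite cats0; exact: tor_nseq_a.
rewrite /tor /pair_word /= -catA ev_nseq_addb catA.
exact: (tor_pair_word ((e (+) f, x) :: ps)).
Qed.

(** * Finite index and exponents *)

(** The elements 1 and b times the eight elements of the dihedral group generated by a and d; they
    represent all cosets of K. *)
Definition coset_word (i : nat) : seq letter :=
  let d8 := [:: [::]; [:: La]; [:: Lx Ld]; [:: La; Lx Ld]; [:: Lx Ld; La];
    [:: La; Lx Ld; La]; [:: Lx Ld; La; Lx Ld]; [:: La; Lx Ld; La; Lx Ld]] in
  nseq (i %/ 8) (Lx Lb) ++ nth [::] d8 (i %% 8).

(* Modulo [K], generated by the conjugates of [t = (ab)^2], the generators [a]
   and [b] commute; a single conjugate of [t] accounts for the exchange. *)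
Definition coset_cert (l : letter) (i j : nat) : bool :=
  let s := rev (coset_word j) ++ l :: coset_word i in
  trivial_word 20 s || has (fun k => trivial_word 20
    (s ++ rev (rev (coset_word k) ++ word_t ++ coset_word k)) || trivial_word 20
    (s ++ rev (rev (coset_word k) ++ rev word_t ++ coset_word k))) (iota 0 16).

Lemma coset_cert_ex l : all (fun i => has (coset_cert l i) (iota 0 16)) (iota 0 16).
Proof. by case: l => [|[]]; lazy. Qed.

Lemma span_word_t : span K_gens (ev word_t).
Proof. exact: (@K_certP _ [:: 0]%N). Qed.

Lemma coset_certP l i j : coset_cert l i j ->
  span K_gens ((ev (coset_word j))^-1 * (gen l * ev (coset_word i))).
Proof.
rewrite evV; have -> : gen l * ev (coset_word i) = ev (l :: coset_word i) by [].
rewrite -ev_cat /coset_cert; move: (rev (coset_word j) ++ _) => s.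
have conj_t k u : span K_gens (ev u) ->
    span K_gens (ev (rev (coset_word k) ++ u ++ coset_word k)).
  move=> /(K_normal (ev (coset_word k))^-1).
  by rewrite invgK evV -!ev_cat -catA.
case/orP=> [h|/hasP[k _ /orP[]h]].
- by rewrite (@ev_eq 20 s [::]) ?cats0//; exact: span1.
- by rewrite (ev_eq h); apply: conj_t; exact: span_word_t.
- rewrite (ev_eq h); apply: conj_t; rewrite -evV.
  exact: (spanV K_gensV span_word_t).
Qed.

Lemma K_cosets g : exists i k,
  [/\ i \in iota 0 16, span K_gens k & g = ev (coset_word i) * k].
Proof.
have [s ->] := grig_word g; elim: s => [|l s [i [k [iI kK sE]]]].
  by exists 0%N, 1; split; rewrite ?mulg1//; exact: span1.
have /hasP[j jI /coset_certP jK] := allP (coset_cert_ex l) i iI.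
exists j, ((ev (coset_word j))^-1 * (gen l * ev (coset_word i)) * k); split => //.
  exact: spanM.
by rewrite -[ev (l :: s)]/(gen l * ev s) sE !mulgA mulgV mul1g.
Qed.

Definition S1 := [seq sigma k | k <- K_gens].
Definition S0 := [seq gen La * sigma k * (gen La)^-1 | k <- K_gens].

Lemma sigma_a : sigma (gen La) = gen La * gen (Lx Lc) * gen La.
Proof.
have -> : gen La = ev [:: La] by rewrite /ev /= mulg1.
by rewrite sigma_ev /ev /= !mulg1 mulgA.
Qed.

Lemma sigma_bcd x : sigma (gen (Lx x)) =
  gen (Lx (match x with Lb => Ld | Lc => Lb | Ld => Lc end)).
Proof.
have -> : gen (Lx x) = ev [:: Lx x] by rewrite /ev /= mulg1.
by case: x; rewrite sigma_ev /ev /= mulg1.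
Qed.

Lemma gen_b : gen (Lx Lb) = gen (Lx Lc) * gen (Lx Ld).
Proof.
have := @ev_eq 3 [:: Lx Lb] [:: Lx Lc; Lx Ld] isT.
by rewrite /ev /= !mulg1.
Qed.


Lemma S01_normal g n : span (S0 ++ S1) n -> span (S0 ++ S1) (g * n * g^-1).
Proof.
exact: (conj01 gen_span (genV La) gen_b sigmaM sigma_a (sigma_bcd Lb)
  (sigma_bcd Lc) (sigma_bcd Ld) K_normal K_comm_d).
Qed.

Lemma grig_S01V : closed_inv (S0 ++ S1).
Proof. exact: (S01V sigmaM K_gensV). Qed.

Lemma evX s n : ev s ^+ n = ev (flatten (nseq n s)).
Proof. by elim: n => // n IH; rewrite expgS IH -ev_cat. Qed.

Lemma word_t_order : ev word_t ^+ 8 = 1.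
Proof. by rewrite evX; exact: (@ev_eq 20 _ [::]). Qed.

Lemma S01_t1 : span (S0 ++ S1) (ev word_t1).
Proof.
have -> : ev word_t1 = sigma (ev word_t) by rewrite sigma_ev; exact: (@ev_eq 20).
by apply: span_gen; rewrite mem_cat orbC /S1 /= inE eqxx.
Qed.

Lemma S01_t0 : span (S0 ++ S1) (ev word_t0).
Proof.
have -> : ev word_t0 = gen La * ev word_t1 * (gen La)^-1.
  rewrite genV; transitivity (ev ([:: La] ++ word_t1 ++ [:: La])).
    exact: (@ev_eq 20).
  by rewrite !ev_cat /ev /= !mulg1 !mulgA.
exact/S01_normal/S01_t1.
Qed.

(** K is generated by t, [(t, 1)] and [(1, t)] with their inverses. The last two lie in the normal
    subgroup generated by [S0] and [S1], so modulo it only powers of t remain, and [t^8 = 1]. *)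
Lemma S01_cosets k : span K_gens k -> exists j n,
  [/\ j \in iota 0 8, span (S0 ++ S1) n & k = ev word_t ^+ j * n].
Proof.
have tX i n : span (S0 ++ S1) n -> exists j n',
    [/\ j \in iota 0 8, span (S0 ++ S1) n' & ev word_t ^+ i * n = ev word_t ^+ j * n'].
  move=> nS; exists (i %% 8)%N, n; split => //; first by rewrite mem_iota ltn_mod.
  by rewrite -(expg_modr word_t_order).
have tN i m n : span (S0 ++ S1) m -> span (S0 ++ S1) n -> exists j n',
    [/\ j \in iota 0 8, span (S0 ++ S1) n' & m * (ev word_t ^+ i * n) = ev word_t ^+ j * n'].
  move=> mS nS; have := tX i ((ev word_t ^+ i)^-1 * m * ev word_t ^+ i * n).
  rewrite !mulgA mulgV mul1g; apply; apply: spanM => //.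
  by rewrite -[X in _ * X]invgK; exact: S01_normal.
elim/span_ind=> [|x {}k xK _ [j [n [_ nS ->]]]].
  by exists 0%N, 1; split; rewrite ?mulg1//; exact: span1.
move: x xK; apply: K_gensP => s.
case=> [<-|[<-|[<-|[<-|[<-|[<-|[]]]]]]]; rewrite -?evV.
- by rewrite mulgA -expgS; exact: tX.
- have -> : (ev word_t)^-1 = ev word_t ^+ 7.
    by apply: (mulgI (ev word_t)); rewrite mulgV -expgS word_t_order.
  by rewrite mulgA -expgnDr; exact: tX.
- exact: (tN _ _ _ S01_t0).
- exact: (tN _ _ _ (spanV grig_S01V S01_t0)).
- exact: (tN _ _ _ S01_t1).
- exact: (tN _ _ _ (spanV grig_S01V S01_t1)).
Qed.

Lemma finite_index : exists T : seq grigorchuk, forall g, exists t n,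
  [/\ t \in T, span (S0 ++ S1) n & g = t * n].
Proof.
exists [seq ev (coset_word i) * ev word_t ^+ j | i <- iota 0 16, j <- iota 0 8].
move=> g; have [i [k [iI /S01_cosets[j [n [jI nS ->]]] ->]]] := K_cosets g.
exists (ev (coset_word i) * ev word_t ^+ j), n; split => //.
  by apply/allpairsP; exists (i, j).
by rewrite mulgA.
Qed.

(** * Iterates of [sigma] and unbounded exponent *)

Lemma iter_sigmaK i k : span K_gens k -> span K_gens (iter i sigma k).
Proof. by move=> kK; elim: i => //= i; exact: K_sigma. Qed.

Lemma iter_sigma_true i (g : grigorchuk) w :
  iter i sigma g (nseq i true ++ w) = nseq i true ++ g w.
Proof. by elim: i => //= i IH; rewrite sigma_true IH. Qed.

Lemma iter_sigma_fix i k w : span K_gens k -> ~~ prefix (nseq i true) w ->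
  iter i sigma k w = w.
Proof.
move=> kK; elim: i w => [|i IH] [|[] w] //=; first by rewrite aut_root.
  by rewrite sigma_true => /IH ->.
by rewrite K_false//; exact: iter_sigmaK.
Qed.

(* An involution of [K], conjugate to [t^4], that moves the vertex 11111. *)
Definition word_swap : seq letter :=
  let g := [:: La; Lx Lb; La; Lx Lb; La; Lx Lb; La; Lx Lc;
    La; Lx Lb; La; Lx Lb; La; Lx Lb; La; Lx Lb] in
  g ++ flatten (nseq 4 word_t) ++ rev g.

Lemma K_swap : span K_gens (ev word_swap).
Proof.
rewrite /word_swap; set g := (X in X ++ _).
rewrite ev_cat (ev_cat _ (rev g)) -evX -evV mulgA.
exact/K_normal/spanX/span_word_t.
Qed.

Lemma swap_involution : ev word_swap * ev word_swap = 1.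
Proof. by rewrite -ev_cat; exact: (@ev_eq 20 _ [::]). Qed.

Lemma swap_moves v : exists u, ev word_swap (nseq 5 true ++ v) = u /\
  ~~ prefix (nseq 5 true) u.
Proof. by eexists; rewrite evE; split; [reflexivity|]. Qed.

(* With [h = sigma^5(k) s] and [s] the involution above, [h^2] acts on the
   subtree at 11111 as [k], so the order of [h] is twice that of [k]. *)
Lemma K_exponent e : (0 < e)%N -> exists2 k, span K_gens k & k ^+ e <> 1.
Proof.
have [n] := ubnP e; elim: n e => // n IH e en e0.
(* An odd power of the involution is the involution itself, which is nontrivial. *)
have [oe|ee] := boolP (odd e).
  exists (ev word_swap); first exact: K_swap.
  rewrite -(odd_double_half e) oe -muln2 mulnC expgnDr expgnA expg2 swap_involution.
  rewrite expg1n mulg1 expg1 => h.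
  have [u [us /negP[]]] := swap_moves [::]; rewrite -us h grig1 cats0.
  exact: prefix_refl.
have eE : e = (2 * e./2)%N by rewrite mul2n even_halfK.
have [k kK ke] : exists2 k, span K_gens k & k ^+ e./2 <> 1 by apply: IH; lia.
pose h := iter 5 sigma k * ev word_swap.
exists h; first by apply: spanM; [exact: iter_sigmaK|exact: K_swap].
have hh w : (h * h) (nseq 5 true ++ w) = nseq 5 true ++ k w.
  have hE v : h v = iter 5 sigma k (ev word_swap v) by [].
  have [u [uE up]] := swap_moves w.
  rewrite (grigM h h) (hE (_ ++ _)) uE iter_sigma_fix// hE -uE.
  by rewrite -(grigM (ev word_swap)) swap_involution grig1 iter_sigma_true.
rewrite eE expgnA expg2 => he; apply: ke; apply: grig_ext => w.
have : ((h * h) ^+ e./2 : grigorchuk) (nseq 5 true ++ w) = nseq 5 true ++ w by rewrite he.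
suff -> : ((h * h) ^+ e./2 : grigorchuk) (nseq 5 true ++ w) =
    nseq 5 true ++ (k ^+ e./2 : grigorchuk) w by move=> [].
elim: (e./2) w => [|m IHm] w //.
by rewrite !expgS (grigM (h * h)) IHm hh.
Qed.

(** As [sigma] is injective, a repetition would make [x] periodic. Then every iterate fixes all
    words, by induction on length: words starting with 0 are fixed since the iterate is in
    [sigma K], and a leading 1 strips one [sigma]. *)
Lemma sigma_iter_inj x : span K_gens x -> x <> 1 ->
  injective (fun i => iter i sigma x).
Proof.
move=> xK x1; have sigma_inj : injective sigma.
  move=> g h gh; apply: grig_ext => w.
  by have := sigma_true g w; rewrite gh sigma_true => -[].
have iter_inj n : injective (iter n sigma).
  by elim: n => // n IH g h /sigma_inj/IH.
have noper p : iter p.+1 sigma x <> x.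
  move=> px; apply: x1; apply: grig_ext => w.
  have [n] := ubnP (size w).
  suff H q : (size w < n)%N -> iter q sigma x w = w by move=> /(H 0).
  elim: n w q => // n IH w q wn; rewrite -[in iter q sigma x]px.
  rewrite -iterD addnS iterS; case: w wn => [|[] w] wn.
  - by rewrite aut_root.
  - by rewrite sigma_true IH.
  - by rewrite K_false//; exact: iter_sigmaK.
have lt i j : (i < j)%N -> iter i sigma x <> iter j sigma x.
  move=> ij; rewrite -(subnKC (ltnW ij)) iterD => /iter_inj h.
  by apply: (noper (j - i).-1); rewrite prednK ?subn_gt0.
by move=> i j; case: (ltngtP i j) => // /lt h; [|move/esym].
Qed.

Theorem corollary5p20 : ~ property_PW grigorchuk.
Proof.
apply: (selfsimilar_not_PW gen_span GsV (genV La) gen_b sigmaM sigma_a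
  (sigma_bcd Lb) (sigma_bcd Lc) (sigma_bcd Ld) K_gensV K_normal K_sigma K_comm
  K_comm_d finite_index _ sigma_iter_inj K_exponent).
by move=> k _; exact: grigorchuk_torsion.
Qed.
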